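(* Let $\mu$ be an admissible even probability measure on $\mathbb{R}$ that satisfies the $\Lambda^{\ast}$-condition. Then for every $\epsilon>0$ there exists $n_0(\mu,\epsilon)\in\mathbb{N}$, depending only on $\epsilon$ and $\mu$, such that for all $r>0$ and all $n\ge n_0(\mu,\epsilon)$, $$\inf_{x\in B_r(\mu_n)}\varphi_{\mu_n}(x)\ge\exp\big(-(1+\epsilon)r-2\epsilon n\big).$$
   Context: Let $X$ have distribution $\mu$. Write $x^{\ast}=\sup\{x\in\mathbb{R}:\mu([x,\infty))>0\}$ (possibly $+\infty$), $\Lambda_\mu(t)=\ln\int e^{tx}\,d\mu(x)$, $\Lambda_\mu^{\ast}(x)=\sup_{t\in\mathbb{R}}\{tx-\Lambda_\mu(t)\}$. The measure $\mu$ is admissible if: $\mathrm{Var}(X)>0$; there is $r>0$ with $\mathbb{E}e^{tX}<\infty$ for $t\in(-r,r)$; if $x^{\ast}<\infty$ then $\mu(\{x^{\ast}\})=0$; and one of: (1) $x^{\ast}<\infty$, (2) $x^{\ast}=+\infty$ and $\{\Lambda_\mu<\infty\}=\mathbb{R}$, (3) $x^{\ast}=+\infty$, $\{\Lambda_\mu<\infty\}$ bounded and $\mu$ log-concave. It satisfies the $\Lambda^{\ast}$-condition if $\lim_{x\uparrow x^{\ast}}\frac{-\ln\mu([x,\infty))}{\Lambda_\mu^{\ast}(x)}=1$. Let $\mu_n=\mu^{\otimes n}$ on $\mathbb{R}^n$, $\Lambda_{\mu_n}(\xi)=\ln\int_{\mathbb{R}^n}e^{\langle\xi,z\rangle}d\mu_n(z)$,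 $\Lambda^{\ast}_{\mu_n}(x)=\sup_{\xi\in\mathbb{R}^n}\{\langle x,\xi\rangle-\Lambda_{\mu_n}(\xi)\}$ (which equals $\sum_{i=1}^n\Lambda_\mu^\ast(x_i)$), and $B_r(\mu_n)=\{x\in\mathbb{R}^n:\Lambda^{\ast}_{\mu_n}(x)\le r\}$. Tukey's half-space depth is $\varphi_{\mu_n}(x)=\inf\{\mu_n(H): H \text{ a half-space of } \mathbb{R}^n \text{ containing } x\}$. *)

(* Defs.v *)
From HB Require Import structures.
From mathcomp Require Import all_boot all_order all_algebra.
From mathcomp Require Import all_classical all_reals all_analysis.
Set Implicit Arguments.
Unset Strict Implicit.
Unset Printing Implicit Defensive.
Import Order.TTheory GRing.Theory Num.Theory numFieldNormedType.Exports.
Local Open Scope classical_set_scope.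
Local Open Scope ring_scope.

Section one_dim.
Context {R : realType}.
Implicit Types (mu : probability R R).
Local Open Scope ereal_scope.

Definition upper_endpoint mu : \bar R :=
  ereal_sup [set x%:E | x in [set x : R | 0 < mu `[x, +oo[%classic]].

Definition laplace mu (t : R) : \bar R := \int[mu]_x (expR (t * x))%:E.

(** Lambda_mu(t) = ln E e^{tX}  (= +oo when the integral is infinite;
    the integral is always > 0 since mu is a probability) *)
Definition Lambda mu (t : R) : \bar R :=
  if laplace mu t == +oo then +oo else (ln (fine (laplace mu t)))%:E.

Definition Lstar mu (x : R) : \bar R :=
  ereal_sup [set (t * x)%:E - Lambda mu t | t in [set: R]].

Definition even_measure mu : Prop :=
  forall A : set R, measurable A -> mu ((fun x => - x)%R @^-1` A) = mu A.

Definition minkowski_comb (l : R) (A B : set R) : set R :=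
  [set (l * a + (1 - l) * b)%R | a in A & b in B].

Definition log_concave_measure mu : Prop :=
  forall (l : R) (A B : set R), (0 < l < 1)%R ->
    measurable A -> measurable B -> measurable (minkowski_comb l A B) ->
    (powR (fine (mu A)) l * powR (fine (mu B)) (1 - l) <=
       fine (mu (minkowski_comb l A B)))%R.

Definition admissible mu : Prop :=
  [/\ 0 < 'V_mu[idfun],
      (exists r : R, (0 < r)%R /\
         forall t : R, (- r < t < r)%R -> laplace mu t < +oo),
      (upper_endpoint mu < +oo -> mu [set fine (upper_endpoint mu)] = 0) &
      [\/ upper_endpoint mu < +oo,
          upper_endpoint mu = +oo /\ (forall t : R, Lambda mu t < +oo) |
          [/\ upper_endpoint mu = +oo,
              (exists M : R, forall t : R, Lambda mu t < +oo -> (`|t| <= M)%R) &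
              log_concave_measure mu]]].

Definition from_below (s : \bar R) : set_system R :=
  match s with
  | r%:E => at_left r
  | +oo => pinfty_nbhs R
  | -oo => ninfty_nbhs R
  end.

Definition Lstar_condition mu : Prop :=
  (fun x : R => (- ln (fine (mu `[x, +oo[%classic)) / fine (Lstar mu x))%R)
    @ from_below (upper_endpoint mu) --> (1%R : R).

End one_dim.

Section n_dim.
Context {R : realType}.
Local Open Scope ereal_scope.

Definition dotv (n : nat) (a z : 'rV[R]_n) : R := (\sum_(i < n) a ord0 i * z ord0 i)%R.

Definition halfspace (n : nat) (H : set 'rV[R]_n) : Prop :=
  exists (a : 'rV[R]_n) (c : R), a != 0%R /\ H = [set z | (c <= dotv a z)%R].

(** X_1, ..., X_n : Omega -> R are i.i.d. with law mu, so that the law of the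
    random vector (X_1,...,X_n) is mu_n = mu^{(x) n}. *)
Definition iid_law d (Omega : measurableType d) (P : probability Omega R)
    (n : nat) (X : 'I_n -> Omega -> R) (mu : probability R R) : Prop :=
  [/\ forall i, measurable_fun setT (X i),
      forall i (A : set R), measurable A -> P (X i @^-1` A) = mu A &
      forall A : 'I_n -> set R, (forall i, measurable (A i)) ->
        P (\bigcap_(i in [set: 'I_n]) (X i @^-1` A i)) =
        \prod_(i < n) P (X i @^-1` A i)].

Definition randvec d (Omega : measurableType d) (n : nat)
    (X : 'I_n -> Omega -> R) (w : Omega) : 'rV[R]_n := \row_i X i w.

Definition mu_n d (Omega : measurableType d) (P : probability Omega R)
    (n : nat) (X : 'I_n -> Omega -> R) (H : set 'rV[R]_n) : \bar R :=
  P (randvec X @^-1` H).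

Definition Lambda_n d (Omega : measurableType d) (P : probability Omega R)
    (n : nat) (X : 'I_n -> Omega -> R) (xi : 'rV[R]_n) : \bar R :=
  let I := \int[P]_w (expR (dotv xi (randvec X w)))%:E in
  if I == +oo then +oo else (ln (fine I))%:E.

Definition Lstar_n d (Omega : measurableType d) (P : probability Omega R)
    (n : nat) (X : 'I_n -> Omega -> R) (x : 'rV[R]_n) : \bar R :=
  ereal_sup [set (dotv x xi)%:E - Lambda_n P X xi | xi in [set: 'rV[R]_n]].

Definition Bball d (Omega : measurableType d) (P : probability Omega R)
    (n : nat) (X : 'I_n -> Omega -> R) (r : R) : set 'rV[R]_n :=
  [set x | Lstar_n P X x <= r%:E].

Definition tukey_depth d (Omega : measurableType d) (P : probability Omega R)
    (n : nat) (X : 'I_n -> Omega -> R) (x : 'rV[R]_n) : \bar R :=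
  ereal_inf [set mu_n P X H | H in [set H | halfspace H /\ H x]].

End n_dim.

(* Main.v *)
(** A half-space through x contains { <a, X - x> >= 0 }.  As mu is even one may
    flip signs so that a_i >= 0, and then replace x_i by y_i = |x_i|, which only
    shrinks the event.  Fix M beyond which the Lambda*-condition gives
    mu[y, oo) >= exp(-(1+eps) Lambda*(y)), some b > M with mu[b, oo) > 0, and
    let S be the sum of the a_i with y_i <= M.  The event contains an intersection
    over three kinds of coordinates, bounded below by independence:
    - y_i > M: require X_i >= y_i;
    - y_i <= M and a_i > S/k: there are at most k of these; require X_i >= b, at a
      total cost exp(O(k));
    - the others: tilt the law of X_i to mean at least y_i + delta, with relative
      entropy at most Lambda*(y_i) + eps/2.
    Since the remaining a_i are at most S/k, under the tilted product law the
    variance of the weighted sum is O(S^2/k), against a drift of at least delta S,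
    so Chebyshev's inequality suffices.  The tilts come from finitely many
    discretized truncations of mu, so every bound is uniform and n_0 depends on mu
    and eps only.  Discretization also reduces the n-dimensional part to finite
    sums; truncation makes exponential moments irrelevant. *)
Require Import Defs.
From HB Require Import structures.
From mathcomp Require Import all_boot all_order all_algebra.
From mathcomp Require Import all_classical all_reals all_analysis.
From mathcomp Require Import measurable_realfun ring lra.
Import Order.TTheory GRing.Theory Num.Theory numFieldNormedType.Exports.
Local Open Scope classical_set_scope.
Local Open Scope ring_scope.

(** * Finite product laws: second moments and change of measure *)

Section finite_product.
Context {R : realType} {I K : finType}.
Implicit Types (q p l v g : I -> K -> R) (w : K -> R).

Definition prod_expect q (F : {ffun I -> K} -> R) : R :=
  \sum_(f : {ffun I -> K}) (\prod_i q i (f i)) * F f.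

Lemma prod_expect_prod q g :
  prod_expect q (fun f => \prod_i g i (f i)) = \prod_i \sum_k q i k * g i k.
Proof.
rewrite bigA_distr_bigA /prod_expect; apply: eq_bigr => f _.
by rewrite -big_split.
Qed.

Context (q : I -> K -> R) (q0 : forall i k, 0 <= q i k)
  (q1 : forall i, \sum_k q i k = 1).

Lemma prod_expect_coord i w : prod_expect q (fun f => w (f i)) = \sum_k q i k * w k.
Proof.
(* Padding with the constant 1 turns a function of one coordinate into a product; the other factors
   become total masses, equal to 1. *)
pose g j k := if j == i then w k else 1.
transitivity (prod_expect q (fun f => \prod_j g j (f j))).
  apply: eq_bigr => f _; congr (_ * _).
  rewrite (bigD1 i) //= /g eqxx big1 ?mulr1 // => j /negbTE -> //.
rewrite prod_expect_prod (bigD1 i) //= /g eqxx [X in _ * X]big1 ?mulr1 // => j /negbTE ji.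
by rewrite ji; under eq_bigr do rewrite mulr1; rewrite q1.
Qed.

Lemma prod_expect_coord2 i j (wi wj : K -> R) : i != j ->
  \sum_k q i k * wi k = 0 -> prod_expect q (fun f => wi (f i) * wj (f j)) = 0.
Proof.
move=> ij wi0.
pose g (l : I) (k : K) := if (l == i)%B then wi k else if (l == j)%B then wj k else 1 : R.
transitivity (prod_expect q (fun f => \prod_j g j (f j))).
  apply: eq_bigr => f _; congr (_ * _).
  rewrite (bigD1 i) //= (bigD1 j) /=; last by rewrite eq_sym.
  rewrite /g eqxx eq_sym (negbTE ij) eqxx big1 ?mulr1 // => l /andP[/negbTE -> /negbTE -> ] //.
by rewrite prod_expect_prod (bigD1 i) //= /g eqxx wi0 mul0r.
Qed.

Lemma prod_expect_sum (J : finType) (F : J -> {ffun I -> K} -> R) :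
  prod_expect q (fun f => \sum_j F j f) = \sum_j prod_expect q (F j).
Proof.
rewrite /prod_expect exchange_big /=; apply: eq_bigr => f _.
by rewrite mulr_sumr.
Qed.

(** Centred coordinates are uncorrelated under a product law, so only the diagonal terms of the
    square survive. *)
Lemma prod_expect_sqr_sum (w : I -> K -> R) : (forall i, \sum_k q i k * w i k = 0) ->
  prod_expect q (fun f => (\sum_i w i (f i)) ^+ 2) = \sum_i \sum_k q i k * w i k ^+ 2.
Proof.
move=> w0.
transitivity (prod_expect q (fun f => \sum_i \sum_j w i (f i) * w j (f j))).
  apply: eq_bigr => f _; congr (_ * _); rewrite expr2 mulr_suml.
  by apply: eq_bigr => i _; rewrite mulr_sumr.
rewrite prod_expect_sum; apply: eq_bigr => i _.
rewrite prod_expect_sum (bigD1 i) //= big1 ?addr0.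
  by rewrite -(prod_expect_coord i (fun k => w i k ^+ 2)); apply: eq_bigr => f _; rewrite expr2.
by move=> j ji; apply: prod_expect_coord2 => //; rewrite eq_sym.
Qed.

Lemma prod_expect_chebyshev (W : {ffun I -> K} -> R) (D : R) : 0 <= D ->
  prod_expect q (fun f => W f ^+ 2) <= D ^+ 2 / 4 ->
  \sum_(f : {ffun I -> K} | D < W f) \prod_i q i (f i) <= 4^-1.
Proof.
move=> D0 WD.
have Q0 (f : {ffun I -> K}) : 0 <= \prod_i q i (f i) by apply: prodr_ge0.
have le_bad : \sum_(f : {ffun I -> K} | D < W f) (\prod_i q i (f i)) * W f ^+ 2
    <= D ^+ 2 / 4.
  apply: le_trans WD; rewrite /prod_expect [leRHS](bigID (fun f : {ffun I -> K} => D < W f)) /=.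
  by rewrite lerDl sumr_ge0 // => f _; rewrite mulr_ge0 ?sqr_ge0.
(* For [D = 0] one cannot divide by [D ^+ 2]; the second moment is then at most 0, so every [f] with
   [W f > 0] has weight 0. *)
have [D_0|Dn0] := eqVneq D 0.
  rewrite big1 ?invr_ge0 // => f; rewrite D_0 => Wf.
  have : (\prod_i q i (f i)) * W f ^+ 2 <= 0.
    apply: le_trans (le_trans le_bad _); last by rewrite D_0 expr0n mul0r.
    rewrite D_0 (bigD1 f) //= lerDl sumr_ge0 // => g _; rewrite mulr_ge0 ?sqr_ge0 //.
  rewrite pmulr_lle0 ?exprn_gt0 // => Qf.
  by apply/eqP; rewrite eq_le Qf Q0.
have D_gt0 : 0 < D by rewrite lt_def Dn0.
rewrite -(@ler_pM2r _ (D ^+ 2)) ?exprn_gt0 // [leRHS]mulrC mulr_suml.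
apply: le_trans le_bad; apply: ler_sum => f Wf.
by rewrite ler_wpM2l // lerXn2r ?nnegrE // ltW // (lt_trans D_gt0).
Qed.

Lemma prod_expect_const1 : \sum_(f : {ffun I -> K}) \prod_i q i (f i) = 1.
Proof. by rewrite -bigA_distr_bigA big1. Qed.

(* Change of measure: p = q exp(-l); on the event where the log-likelihood sum
   exceeds its mean by at most s, passing from q to p costs exp(-(mean + s)). *)
Lemma tilted_sum_ge (p l v : I -> K -> R) (a y : I -> R) (s : R) :
  (forall i k, p i k = q i k * expR (- l i k)) -> 0 <= s ->
  \sum_i \sum_k q i k * (l i k - \sum_j q i j * l i j) ^+ 2 <= s ^+ 2 / 4 ->
  0 <= \sum_i a i * (\sum_k q i k * v i k - y i) ->
  \sum_i a i ^+ 2 * (\sum_k q i k * (v i k - \sum_j q i j * v i j) ^+ 2) <=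
    (\sum_i a i * (\sum_k q i k * v i k - y i)) ^+ 2 / 4 ->
  expR (- (\sum_i \sum_k q i k * l i k) - s) / 2 <=
  \sum_(f : {ffun I -> K} | \sum_i a i * y i <= \sum_i a i * v i (f i))
     \prod_i p i (f i).
Proof.
move=> pql s0 varl D0 varv.
pose h i := \sum_k q i k * l i k; pose m i := \sum_k q i k * v i k.
set D := \sum_i a i * _ in D0 varv.
pose Wl (f : {ffun I -> K}) := \sum_i (l i (f i) - h i).
(* The sign is reversed because it is the downward deviation of the weighted sum that must be
   controlled. *)
pose Wv (f : {ffun I -> K}) := \sum_i - (a i * (v i (f i) - m i)).
have badl : \sum_(f : {ffun I -> K} | s < Wl f) \prod_i q i (f i) <= 4^-1.
  apply: prod_expect_chebyshev => //; rewrite (prod_expect_sqr_sum (fun i k => l i k - h i)) //.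
  move=> i; under eq_bigr do rewrite mulrBr.
  by rewrite sumrB -mulr_suml q1 mul1r subrr.
have badv : \sum_(f : {ffun I -> K} | D < Wv f) \prod_i q i (f i) <= 4^-1.
  apply: prod_expect_chebyshev => //.
  rewrite (prod_expect_sqr_sum (fun i k => - (a i * (v i k - m i)))).
    apply: le_trans varv; apply: ler_sum => i _; rewrite mulr_sumr le_eqVlt.
    by apply/orP; left; apply/eqP/eq_bigr => k _; rewrite /m; ring.
  move=> i; under eq_bigr => k _ do rewrite mulrN mulrCA mulrBr mulrBr.
  rewrite sumrN sumrB -!mulr_sumr -mulr_suml q1 mul1r.
  by rewrite subrr oppr0.
(* Each bad event has mass at most 1/4, so the good event keeps mass 1/2; this is the factor 1/2 in
   the conclusion. *)
pose good (f : {ffun I -> K}) := (Wl f <= s) && (Wv f <= D).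
have Q0 (f : {ffun I -> K}) : 0 <= \prod_i q i (f i) by apply: prodr_ge0.
have Qgood : 2^-1 <= \sum_(f : {ffun I -> K} | good f) \prod_i q i (f i).
  have := prod_expect_const1; rewrite (bigID good) /= => tot.
  suff : \sum_(f : {ffun I -> K} | ~~ good f) \prod_i q i (f i) <= 4^-1 + 4^-1 by lra.
  apply: le_trans (lerD badl badv).
  rewrite big_mkcond [in leRHS]big_mkcond [X in _ <= _ + X]big_mkcond -big_split /=.
  apply: ler_sum => f _; rewrite /good negb_and -!ltNge.
  by have := Q0 f; case: (s < Wl f); case: (D < Wv f) => /=; lra.
set Gd := (X in _ <= \sum_(f | X f) _).
apply: (@le_trans _ _ (\sum_(f : {ffun I -> K} | good f) \prod_i p i (f i))).
  rewrite mulrC -ler_pdivlMr ?expR_gt0 // -expRN.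
  apply: (le_trans Qgood); rewrite mulr_suml; apply: ler_sum => f /andP[gl gv].
  under [X in _ <= X * _]eq_bigr do rewrite pql.
  rewrite big_split /= -expR_sum -mulrA -expRD ler_peMr // -expR0 ler_expR.
  move: gl; rewrite /Wl sumrB sumrN; rewrite -/h; lra.
rewrite [leRHS](bigID good) /=.
rewrite [X in _ <= X + _](_ : _ = \sum_(f : {ffun I -> K} | good f) \prod_i p i (f i)).
  rewrite lerDl sumr_ge0 // => f _; apply: prodr_ge0 => i _.
  by rewrite pql mulr_ge0 // expR_ge0.
(* On the good event the weighted sum falls below its mean by at most [D], which is exactly the gap
   between that mean and the threshold. *)
apply: eq_bigl => f; apply: andb_idl => /andP[_]; rewrite /Wv /D /Gd => gv.
rewrite -subr_ge0 -sumrB; move: gv; rewrite -subr_ge0 -sumrB.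
by congr (_ <= _); apply: eq_bigr => i _; rewrite /m; ring.
Qed.

End finite_product.

(** * Laplace transform and Legendre transform of an even law *)

Section one_dimensional.
Context {R : realType} (mu : probability R R).
Implicit Types (t x y c : R).
Local Open Scope ereal_scope.

Lemma measurable_expR_mul t (D : set R) :
  measurable_fun D (fun x => (expR (t * x))%:E).
Proof.
apply: measurable_funTS; apply/measurable_EFinP.
by apply: (measurableT_comp (@measurable_expR R)); apply: mulrl_measurable.
Qed.

Lemma laplace_ge0 t : 0 <= laplace mu t.
Proof. by apply: integral_ge0 => x _; rewrite lee_fin expR_ge0. Qed.

(** Markov's inequality for the exponential: restrict the integral to the tail. *)
Lemma laplace_ge_tail t x : (0 <= t)%R ->
  (expR (t * x))%:E * mu `[x, +oo[%classic <= laplace mu t.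
Proof.
move=> t0; rewrite -integral_cst //.
apply: (@le_trans _ _ (\int[mu]_(y in `[x, +oo[) (expR (t * y))%:E)).
  apply: ge0_le_integral => //.
  - by move=> y _; rewrite lee_fin expR_ge0.
  - exact: measurable_expR_mul.
  - move=> y /=; rewrite in_itv /= andbT => xy.
    by rewrite lee_fin ler_expR ler_wpM2l.
apply: ge0_subset_integral => //; exact: measurable_expR_mul.
Qed.

Hypothesis mu_even : even_measure mu.

(** The two closed half-lines at 0 cover the line and have equal mass by evenness. *)
Lemma tail0_ge_half : (2^-1)%:E <= mu `[0%R, +oo[%classic.
Proof.
have E : mu `]-oo, 0%R]%classic = mu `[0%R, +oo[%classic.
  rewrite -(mu_even `[0%R, +oo[%classic) //; congr (mu _).
  by apply/seteqP; split => x /=; rewrite !in_itv /= ?andbT oppr_ge0.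
have : mu setT <= mu `[0%R, +oo[%classic + mu `]-oo, 0%R]%classic.
  rewrite (_ : setT = `]-oo, 0%R]%classic `|` `[0%R, +oo[%classic).
    by rewrite addeC; apply: measureU2.
  apply/seteqP; split => x //= _; rewrite !in_itv /= andbT.
  by have [] := leP x 0%R; [left|move=> /ltW; right].
rewrite probability_setT E -(fineK (fin_num_measure mu _ _)) //.
by rewrite -EFinD !lee_fin; lra.
Qed.

Lemma laplace_even t : laplace mu (- t) = laplace mu t.
Proof.
rewrite /laplace.
transitivity (\int[pushforward mu (-%R : R -> R)]_x (expR (t * x))%:E).
  rewrite ge0_integral_pushforward //=.
  - by apply: eq_integral => x _ /=; rewrite mulNr mulrN.
  - exact: measurable_expR_mul.
apply: eq_measure_integral => A mA _.
exact: mu_even.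
Qed.

Lemma laplace_gt0 t : 0 < laplace mu t.
Proof.
wlog t0 : t / (0 <= t)%R.
  move=> H; have [/H //|/ltW t0] := leP 0%R t.
  by rewrite -laplace_even; apply: H; rewrite oppr_ge0.
apply: lt_le_trans (laplace_ge_tail _ 0%R t0); rewrite mulr0 expR0 mul1e.
by apply: lt_le_trans tail0_ge_half; rewrite lte_fin invr_gt0.
Qed.

Lemma Lambda_even t : Lambda mu (- t) = Lambda mu t.
Proof. by rewrite /Lambda laplace_even. Qed.

Lemma Lstar_ge t x : (t * x)%:E - Lambda mu t <= Lstar mu x.
Proof. by apply: ereal_sup_ubound; exists t. Qed.

Lemma Lstar_even x : Lstar mu (- x) = Lstar mu x.
Proof.
suff H y : Lstar mu (- y) <= Lstar mu y.
  by apply/eqP; rewrite eq_le H -{1}(opprK x) H.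
apply: ub_ereal_sup => _ [t _ <-].
by rewrite mulrN -mulNr -Lambda_even; apply: Lstar_ge.
Qed.

Lemma Lstar_norm x : Lstar mu `|x|%R = Lstar mu x.
Proof. by have [x0|x0] := ger0P x; rewrite // Lstar_even. Qed.

(** By evenness of [Lambda], replacing a negative [t] by [- t] does not decrease the objective when
    [x] is nonnegative. *)
Lemma Lstar_le x (c : \bar R) : (0 <= x)%R ->
  (forall t, (0 <= t)%R -> (t * x)%:E - Lambda mu t <= c) -> Lstar mu x <= c.
Proof.
move=> x0 H; apply: ub_ereal_sup => _ [t _ <-].
have [/H //|/ltW t0] := leP 0%R t.
apply: (@le_trans _ _ ((- t * x)%:E - Lambda mu (- t))).
  by rewrite Lambda_even leeB // lee_fin ler_wpM2r // lerNr (le_trans t0) // oppr_ge0.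
by apply: H; rewrite oppr_ge0.
Qed.

Lemma le_Lstar x y : (0 <= x <= y)%R -> Lstar mu x <= Lstar mu y.
Proof.
move=> /andP[x0 xy]; apply: Lstar_le => // t t0.
by apply: le_trans (Lstar_ge t y); rewrite leeB // lee_fin ler_wpM2l.
Qed.

Lemma Lstar_ge0 x : 0 <= Lstar mu x.
Proof.
have laplace0 : laplace mu 0%R = 1.
  rewrite /laplace; under eq_integral do rewrite mul0r expR0.
  by rewrite integral_cst // mul1e; exact: probability_setT.
apply: le_trans (Lstar_ge 0%R x).
by rewrite mul0r /Lambda laplace0 /= ln1 sube0.
Qed.

(** Fenchel-Young in exponential form, which keeps its meaning where the Laplace transform is
    infinite. *)
Lemma laplace_ge t x : Lstar mu x < +oo ->
  (expR (t * x - fine (Lstar mu x)))%:E <= laplace mu t.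
Proof.
move=> Lx; have Lfin : Lstar mu x \is a fin_num.
  by rewrite ge0_fin_numE // Lstar_ge0.
have := Lstar_ge t x; rewrite -{1}(fineK Lfin) /Lambda.
have := laplace_gt0 t; case: (laplace mu t) => [l| |] //=; last first.
  by rewrite leey.
rewrite lte_fin => l0; rewrite -EFinB !lee_fin => H.
by rewrite -[leRHS](lnK l0) ler_expR; lra.
Qed.

(** Chernoff's bound, read as an upper bound on [Lstar]. *)
Lemma Lstar_le_tail x : (0 <= x)%R -> 0 < mu `[x, +oo[%classic ->
  Lstar mu x <= (- ln (fine (mu `[x, +oo[%classic)))%:E.
Proof.
move=> x0; have mufin := fin_num_measure mu `[x, +oo[%classic (measurable_itv _).
rewrite -{1}(fineK mufin) lte_fin => tail0; apply: Lstar_le => // t t0.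
have := laplace_ge_tail _ x t0; rewrite -{1}(fineK mufin) /Lambda.
have := laplace_gt0 t; case: (laplace mu t) => [l| |] //=; last by rewrite leNye.
rewrite lte_fin => l0; rewrite -EFinM -EFinB !lee_fin.
rewrite -ler_ln ?posrE ?mulr_gt0 ?expR_gt0 // lnM ?posrE ?expR_gt0 // expRK.
by lra.
Qed.

(** Almost surely X < x. Above [x - e] the integrand is at most exp(tx), below it at most exp(t(x -
    e)). *)
Lemma laplace_le t x (e : R) : (0 <= t)%R -> (0 < e)%R -> mu `[x, +oo[%classic = 0 ->
  laplace mu t <=
  (expR (t * x))%:E * (mu `[(x - e)%R, +oo[%classic + (expR (- (t * e)))%:E).
Proof.
move=> t0 e0 tail_0; rewrite /laplace.
have pos_expR y : 0 <= (expR (t * y))%:E by rewrite lee_fin expR_ge0.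
have -> : [set: R] = `]-oo, x[%classic `|` `[x, +oo[%classic.
  apply/seteqP; split => y //= _; rewrite !in_itv /= andbT.
  by have [] := ltP y x; [left|right].
rewrite ge0_integral_setU //=; last 2 first.
- exact: measurable_expR_mul.
- rewrite disj_set2E; apply/eqP/seteqP; split => y //=; rewrite !in_itv /= andbT.
  by case=> /lt_le_trans yx /yx; rewrite ltxx.
rewrite [X in _ + X]null_set_integral //; last exact: measurable_expR_mul.
rewrite adde0.
pose g (y : R) : \bar R := (expR (t * x))%:E * (\1_(`[(x - e)%R, +oo[%classic) y)%:E
  + (expR (t * x) * expR (- (t * e)))%:E.
apply: (@le_trans _ _ (\int[mu]_y g y)).
  apply: (@le_trans _ _ (\int[mu]_(y in `]-oo, x[) g y)).
    apply: ge0_le_integral => //.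
    - exact: measurable_expR_mul.
    - apply: emeasurable_funD => //; apply: measurable_funeM.
      by apply/measurable_EFinP; apply: measurable_funTS; exact: measurable_indic.
    - move=> y /=; rewrite in_itv /= => yx; rewrite /g -EFinM -EFinD lee_fin indicE.
      have [xy|xy] := leP (x - e)%R y.
        rewrite mem_set /= ?in_itv /= ?xy // mulr1.
        rewrite -[leLHS]addr0 lerD ?mulr_ge0 ?expR_ge0 //.
        by rewrite ler_expR ler_wpM2l // ltW.
      rewrite memNset /= ?in_itv /= ?andbT; last by apply/negP; rewrite -ltNge.
      by rewrite mulr0 add0r -expRD ler_expR -mulrBr ler_wpM2l // ltW.
  apply: ge0_subset_integral => //.
    apply: emeasurable_funD => //; apply: measurable_funeM.
    by apply/measurable_EFinP; exact: measurable_indic.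
  by move=> y _; rewrite /g -EFinM -EFinD lee_fin addr_ge0 ?mulr_ge0 ?expR_ge0.
rewrite /g ge0_integralD //=; last first.
  by apply: measurable_funeM; apply/measurable_EFinP; exact: measurable_indic.
rewrite ge0_integralZl_EFin ?expR_ge0 //; last first.
  by apply/measurable_EFinP; exact: measurable_indic.
rewrite integral_indic // setIT integral_cst //.
rewrite [X in _ + _ * X](_ : _ = 1) ?mule1; last exact: probability_setT.
by rewrite EFinM -ge0_muleDr // lee_fin expR_ge0.
Qed.

(** The mass of [x - e, +oo) tends to 0 with [e]. Fixing [e] with mass below [d / 2] and then taking
    [t] large makes both terms of [laplace_le] small, so that tx - Lambda(t) is at least [c]. *)
Lemma Lstar_no_tail x : mu `[x, +oo[%classic = 0 -> Lstar mu x = +oo.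
Proof.
move=> tail_0; apply/eqyP => c c0; set d := expR (- c).
have d0 : (0 < d)%R by exact: expR_gt0.
have : (fun n : nat => mu `[(x - n.+1%:R^-1)%R, +oo[%classic) @ \oo --> 0.
  rewrite -[X in _ --> X]tail_0 (_ : `[x, +oo[%classic =
      \bigcap_n `[(x - n.+1%:R^-1)%R, +oo[%classic).
    apply: nonincreasing_cvg_mu => //.
    - by rewrite ltey_eq fin_num_measure.
    - exact: bigcapT_measurable.
    - move=> m n mn; apply/subsetPset => y /=; rewrite !in_itv /= !andbT.
      by apply: le_trans; rewrite lerD2l lerN2 lef_pV2 ?posrE // ler_nat.
  apply/seteqP; split => y /=.
    rewrite in_itv /= andbT => xy n _ /=; rewrite in_itv /= andbT.
    by rewrite (le_trans _ xy) // gerBl.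
  move=> H; rewrite in_itv /= andbT leNgt; apply/negP => yx.
  have [n] := ltr_add_invr yx; rewrite ltNge => /negP; apply.
  by have := H n I; rewrite /= in_itv /= andbT lerBlDr.
move/fine_cvgP => [_ /cvgrPdist_lt /(_ (d / 2)%R)].
rewrite divr_gt0 // => /(_ isT)[n _ /(_ n (leqnn _))].
rewrite /= sub0r normrN => /(le_lt_trans (ler_norm _)).
set e : R := (n.+1%:R^-1)%R; set T := mu `[(x - e)%R, +oo[%classic => Td.
have e0 : (0 < e)%R by rewrite invr_gt0.
pose t := (`|ln (d / 2)| / e)%R.
have t0 : (0 <= t)%R by rewrite divr_ge0 // ltW.
apply: (@le_trans _ _ ((t * x)%:E - Lambda mu t)); last exact: Lstar_ge.
have te : (expR (- (t * e)) <= d / 2)%R.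
  rewrite /t divfK ?gt_eqF // -[leRHS]lnK ?posrE ?divr_gt0 // ler_expR.
  by rewrite lerNl -normrN ler_norm.
have Tfin : T \is a fin_num by exact: fin_num_measure.
have := laplace_le t x e t0 e0 tail_0; rewrite -/T -(fineK Tfin) /Lambda.
have := laplace_gt0 t; case: (laplace mu t) => [l| |] //=.
rewrite lte_fin => l0; rewrite -EFinD -EFinM -EFinB !lee_fin => lb.
have {}lb : (l <= expR (t * x) * d)%R.
  by apply: (le_trans lb); rewrite ler_wpM2l ?expR_ge0 //; lra.
move: lb; rewrite -ler_ln ?posrE ?mulr_gt0 ?expR_gt0 //.
by rewrite lnM ?posrE ?expR_gt0 // !expRK; lra.
Qed.

End one_dimensional.

(** * The right endpoint of the support and the Lambda*-condition *)

Section endpoint.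
Context {R : realType} (mu : probability R R).
Implicit Types (x M b e : R).
Local Open Scope ereal_scope.
Hypothesis mu_even : even_measure mu.
Hypothesis no_atom : upper_endpoint mu < +oo -> mu [set fine (upper_endpoint mu)] = 0.

(** The open half-line beyond the endpoint is a countable union of null tails, and the endpoint
    itself carries no atom. *)
Lemma endpoint_no_tail r : upper_endpoint mu = r%:E -> mu `[r, +oo[%classic = 0.
Proof.
move=> sr; have := no_atom; rewrite sr ltry => /(_ isT) /= atom0.
have open0 : mu.-negligible `]r, +oo[%classic.
  rewrite (_ : `]r, +oo[%classic = \bigcup_n `[(r + n.+1%:R^-1)%R, +oo[%classic).
    apply: negligible_bigcup => n; apply/negligibleP => //.
    apply/eqP; rewrite eq_le measure_ge0 andbT leNgt; apply/negP => H.
    have : (r + n.+1%:R^-1)%:E <= upper_endpoint mu.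
      by apply: ereal_sup_ubound; exists (r + n.+1%:R^-1)%R.
    by rewrite sr lee_fin leNgt ltrDl invr_gt0 ltr0Sn.
  apply/seteqP; split => y /=.
    rewrite in_itv /= andbT => /ltr_add_invr[n yn]; exists n => //=.
    by rewrite in_itv /= andbT ltW.
  move=> [n _] /=; rewrite !in_itv /= !andbT; apply: lt_le_trans.
  by rewrite ltrDl invr_gt0.
have U : mu ([set r] `|` `]r, +oo[%classic) <= mu [set r] + mu `]r, +oo[%classic.
  exact: measureU2.
apply/eqP; rewrite eq_le measure_ge0 andbT -(@setU1itv _ _ _ _ false) //.
apply: (le_trans U); rewrite atom0 add0e.
by move/negligibleP : open0 => -> //.
Qed.

Lemma Lstar_lty_tail x : Lstar mu x < +oo -> 0 < mu `[x, +oo[%classic.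
Proof.
move=> Lx; rewrite lt_neqAle measure_ge0 andbT eq_sym; apply/eqP => tail_0.
by move: Lx; rewrite Lstar_no_tail // ltxx.
Qed.

(** A null tail forces an infinite [Lstar]. Hence coordinates with finite [Lstar] stay in the range
    where the limit in [Lstar_condition] can be used. *)
Lemma Lstar_lty_endpoint x : Lstar mu x < +oo -> x%:E < upper_endpoint mu.
Proof.
move=> Lx; have tail := Lstar_lty_tail _ Lx.
rewrite lt_neqAle; apply/andP; split; last by apply: ereal_sup_ubound; exists x.
apply/eqP => /esym/endpoint_no_tail tail_0.
by move: tail; rewrite tail_0 ltxx.
Qed.

Lemma Lstar0_lty : Lstar mu 0%R < +oo.
Proof.
apply: (le_lt_trans (Lstar_le_tail _ mu_even _ (lexx _) _)); last exact: ltry.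
by apply: lt_le_trans (tail0_ge_half _ mu_even); rewrite lte_fin invr_gt0.
Qed.

Lemma Lstar_condition_tail e : Lstar_condition mu -> (0 < e)%R ->
  exists M b, [/\ (0 <= M)%R, (M < b)%R, 0 < mu `[b, +oo[%classic &
    forall x, (M <= x)%R -> Lstar mu x < +oo ->
      (- ln (fine (mu `[x, +oo[%classic)) <= (1 + e) * fine (Lstar mu x))%R].
Proof.
move=> cond e0; pose e' := Num.min e (2^-1)%R.
(* The cap 1/2 excludes [L = 0] below: division by zero returns 0, which would put the quotient at
   distance 1 from its limit. *)
have e'0 : (0 < e')%R by rewrite lt_min e0 invr_gt0 /=.
pose f x := (- ln (fine (mu `[x, +oo[%classic)) / fine (Lstar mu x))%R.
have s0 := Lstar_lty_endpoint _ Lstar0_lty.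
have [M [M0 Ms Mf]] : exists M, [/\ (0 <= M)%R, M%:E < upper_endpoint mu &
    forall x, (M <= x)%R -> x%:E < upper_endpoint mu -> (`|1 - f x| <= e')%R].
  move: cond s0; rewrite /Lstar_condition -/f.
  case: (upper_endpoint mu) => [r| |] //= /cvgrPdist_le /(_ _ e'0).
    move=> [d /= d0 H]; rewrite lte_fin => r0.
    (* Halving [d] keeps [M, r) strictly inside the neighbourhood of radius [d]. *)
    exists (Num.max 0 (r - d / 2))%R; split.
    - by rewrite le_max lexx.
    - by rewrite lte_fin gt_max r0 /=; lra.
    - move=> x; rewrite ge_max lte_fin => /andP[x0 rx] xr; apply: H => //=.
      by rewrite ger0_norm; lra.
  move=> [A [_ H]] _; exists (Num.max 0 (A + 1))%R; split.
  - by rewrite le_max lexx.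
  - by rewrite ltry.
  - by move=> x; rewrite ge_max => /andP[x0 Ax] _; apply: H; lra.
have [_ [b b_tail <-]] := ereal_sup_gt Ms; rewrite lte_fin => Mb.
exists M, b; split => // x Mx Lx.
have := Mf x Mx (Lstar_lty_endpoint _ Lx); rewrite /f.
set a := (- ln _)%R; set L := fine _.
have L0 : (0 <= L)%R by apply: fine_ge0; apply: Lstar_ge0.
have e'le : (e' <= e)%R by rewrite ge_min lexx.
have e'half : (e' <= 2^-1)%R by rewrite ge_min lexx orbT.
have [->|Ln0] := eqVneq L 0%R; first by rewrite invr0 mulr0 subr0 normr1; lra.
have Lgt0 : (0 < L)%R by rewrite lt_def Ln0.
rewrite ler_distlC => /andP[_ H].
by rewrite -ler_pdivrMr //; lra.
Qed.

End endpoint.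

(** * Discretization of the line *)

Section cells.
Context {R : realType}.
Implicit Types (B eta x : R).

(** Cells of width [eta] start at [- B], and the last one is a half-line, whence the truncation by
    [B] in the upper estimate. Rounding down to left endpoints is safe for lower bounds on upper
    half-spaces. *)
Lemma cells_exist B eta : 0 < eta ->
  exists (N : nat) (A : 'I_N -> set R) (v : 'I_N -> R),
  [/\ forall k, measurable (A k), trivIset setT A,
      forall k x, A k x -> v k <= x /\ Num.min x B <= v k + eta &
      forall x, - B <= x -> exists k, A k x].
Proof.
move=> eta0; pose N := (Num.trunc (2 * B / eta)).+1.
pose v (k : nat) : R := - B + k%:R * eta.
pose ub (k : nat) : itv_bound R := if k == N then +oo%O else BLeft (v k.+1).
have vN : B <= v N.
  have : 2 * B / eta <= N%:R.
    have [B0|B0] := leP 0 (2 * B / eta); last by rewrite (le_trans (ltW B0)).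
    by rewrite ltW //; have /andP[] := truncn_itv B0.
  by rewrite ler_pdivrMr // /v; lra.
have vS k : v k.+1 = v k + eta by rewrite /v -natr1; ring.
exists N.+1, (fun k => [set` Interval (BLeft (v k)) (ub k)]), (fun k => v k).
split.
- by move=> k; exact: measurable_itv.
- apply/trivIsetP => i j _ _; wlog ij : i j / (i < j)%N.
    by move=> H; rewrite neq_ltn => /orP[] ij; [|rewrite setIC]; apply: H => //;
      rewrite neq_ltn ij ?orbT.
  move=> _; apply/seteqP; split => x //= []; rewrite !itv_boundlr /= => /andP[_].
  rewrite /ub ltn_eqF; last by rewrite (leq_trans ij) // -ltnS.
  rewrite bnd_simp => xi /andP[]; rewrite bnd_simp => jx _.
  have : v i.+1 <= v j by rewrite /v lerD2l ler_pM2r // ler_nat.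
  by move/le_trans => /(_ _ jx); rewrite leNgt xi.
- move=> k x /=; rewrite itv_boundlr /= /ub => /andP[]; rewrite bnd_simp => kx.
  case: eqP => [kN _|_ H]; split => //.
    rewrite kN ge_min; apply/orP; right; rewrite (le_trans vN) // lerDl ltW //.
  by move: H; rewrite bnd_simp vS ge_min => /ltW ->.
move=> x Bx; set n := Num.trunc ((x + B) / eta).
have : 0 <= (x + B) / eta by rewrite divr_ge0 ?(ltW eta0) // -lerBlDr sub0r.
move/truncn_itv; rewrite -/n ler_pdivlMr // ltr_pdivrMr // => /andP[n1 n2].
have [nN|Nn] := ltnP n N.
  have nN' : (n < N.+1)%N by rewrite ltnW.
  exists (Ordinal nN') => /=; rewrite itv_boundlr /ub /= ltn_eqF // !bnd_simp /v.
  by apply/andP; split; lra.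
exists ord_max => /=; rewrite itv_boundlr /ub /= eqxx !bnd_simp /v andbT.
have : N%:R * eta <= n%:R * eta by rewrite ler_pM2r // ler_nat.
by lra.
Qed.

End cells.

(** * Product cells under independence *)

Section independent_cells.
Context {R : realType} (mu : probability R R).
Context d (Omega : measurableType d) (P : probability Omega R) (n : nat)
  (X : 'I_n -> Omega -> R).
Hypothesis iidX : iid_law P X mu.
Context (K : finType) (A : 'I_n -> K -> set R).
Hypothesis mA : forall i k, measurable (A i k).
Hypothesis tA : forall i, trivIset setT (A i).

Definition cell_event (f : {ffun 'I_n -> K}) : set Omega :=
  \bigcap_(i in [set: 'I_n]) (X i @^-1` A i (f i)).

Lemma measurable_cell_event f : measurable (cell_event f).
Proof.
have [mX _ _] := iidX.
apply: fin_bigcap_measurable => [|i _]; first exact: finite_finset.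
by rewrite -[X in measurable X]setTI; exact: mX.
Qed.

Lemma cell_event_prob f :
  P (cell_event f) = (\prod_i fine (mu (A i (f i))))%:E.
Proof.
have [_ lawX indX] := iidX.
rewrite indX // -prodEFin; apply: eq_bigr => i _.
by rewrite lawX // fineK // fin_num_measure.
Qed.

Lemma trivIset_cell_event : trivIset setT cell_event.
Proof.
apply/trivIsetP => f g _ _ fg; apply/seteqP; split => w //= [Ef Eg].
move/negP: fg; apply; apply/eqP/ffunP => i.
apply/eqP/negP => /negP fgi.
have /trivIsetP /(_ _ _ I I fgi) := tA i.
by apply/eqP/set0P; exists (X i w); split; [exact: Ef|exact: Eg].
Qed.

(** The way back from finite sums to [P]: cell events are disjoint and have product
    probabilities. *)
Lemma cell_event_sum_le (S : pred {ffun 'I_n -> K}) (D : set Omega) :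
  measurable D -> (forall f, S f -> cell_event f `<=` D) ->
  ((\sum_(f : {ffun 'I_n -> K} | S f) \prod_i fine (mu (A i (f i))))%:E <= P D)%E.
Proof.
move=> mD SD.
rewrite -sumEFin; under eq_bigr do rewrite -cell_event_prob.
rewrite -big_filter; set s := [seq _ <- _ | _].
have us : uniq s by rewrite filter_uniq // index_enum_uniq.
rewrite (fsbig_seq _ _ us) -measure_fin_bigcup //.
- apply: le_measure; rewrite ?inE //.
    by apply: fin_bigcup_measurable => // f _; exact: measurable_cell_event.
  by move=> w [f /=]; rewrite mem_filter => /andP[/SD fD _] /fD.
- exact: (sub_trivIset _ trivIset_cell_event).
- by move=> f _; exact: measurable_cell_event.
Qed.

End independent_cells.

Arguments cell_event {R d Omega n} X {K} A f.
Arguments measurable_cell_event {R mu d Omega P n X} iidX {K A} mA f.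
Arguments cell_event_prob {R mu d Omega P n X} iidX {K A} mA f.
Arguments trivIset_cell_event {R d Omega n} X {K A} tA.
Arguments cell_event_sum_le {R mu d Omega P n X} iidX {K A} mA tA S D.

(** * Laplace transform of a sum of independent coordinates *)

Section laplace_product.
Context {R : realType} (mu : probability R R).
Local Open Scope ereal_scope.

(** On a cell, [t * v k + |t| * eta] exceeds [t * x] by at most [2 * |t| * eta]. *)
Lemma laplace_cells_le (K : finType) (A : K -> set R) (v : K -> R) (t eta : R) :
  (forall k, measurable (A k)) -> trivIset setT A ->
  (forall k x, A k x -> (v k <= x <= v k + eta)%R) -> laplace mu t < +oo ->
  (\sum_k expR (t * v k + `|t| * eta) * fine (mu (A k)) <=
   expR (2 * `|t| * eta) * fine (laplace mu t))%R.
Proof.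
move=> mA tA vA lt; rewrite -lee_fin EFinM fineK; last first.
  by rewrite ge0_fin_numE // laplace_ge0.
have pos (D : set R) x : D x -> 0 <= (expR (t * x))%:E by rewrite lee_fin expR_ge0.
apply: (@le_trans _ _ ((expR (2 * `|t| * eta))%:E *
    \sum_k \int[mu]_(x in A k) (expR (t * x))%:E)); last first.
  rewrite lee_pmul2l ?lte_fin ?expR_gt0 //.
  rewrite -ge0_integral_bigsetU //; last 3 first.
  - exact: index_enum_uniq.
  - exact: (sub_trivIset _ tA).
  - exact: measurable_expR_mul.
  apply: ge0_subset_integral => //.
  - by apply: bigsetU_measurable => k _.
  - exact: measurable_expR_mul.
rewrite ge0_sume_distrr; last by move=> k _; apply: integral_ge0.
rewrite -sumEFin; apply: lee_sum => k _.
rewrite EFinM fineK ?fin_num_measure // -integral_cst //.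
rewrite -ge0_integralZl_EFin ?expR_ge0 //; last exact: measurable_expR_mul.
apply: ge0_le_integral => //.
- by move=> x _; rewrite lee_fin expR_ge0.
- by apply: measurable_funeM; exact: measurable_expR_mul.
move=> x /vA /andP[vx xv]; rewrite -EFinM lee_fin -expRD ler_expR.
have : (`|t * (v k - x)| <= `|t| * eta)%R.
  by rewrite normrM ler_wpM2l // ler_norml; apply/andP; split; lra.
by rewrite ler_norml => /andP[_]; lra.
Qed.

Context d (Omega : measurableType d) (P : probability Omega R) (n : nat)
  (X : 'I_n -> Omega -> R).
Hypothesis iidX : iid_law P X mu.

Lemma measurable_expR_dot (t : 'I_n -> R) (D : set Omega) :
  measurable_fun D (fun w => (expR (\sum_i t i * X i w))%:E).
Proof.
have [mX _ _] := iidX.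
apply: measurable_funTS; apply/measurable_EFinP.
apply: (measurableT_comp (@measurable_expR R)); apply: measurable_sum => i.
exact: measurable_funM.
Qed.

(** Independence is stated for events, so the integral is factorized through product cells; the
    error factor tends to 1 as [eta] tends to 0. *)
Lemma laplace_box_le (t : 'I_n -> R) (B eta : R) (D : set Omega) :
  (0 < eta)%R -> (forall i, laplace mu (t i) < +oo) -> measurable D ->
  (forall w, D w -> forall i, (- B <= X i w < B)%R) ->
  \int[P]_(w in D) (expR (\sum_i t i * X i w))%:E <=
  (expR (2 * eta * \sum_i `|t i|) * \prod_i fine (laplace mu (t i)))%:E.
Proof.
move=> eta0 lt mD DB; have [mX _ _] := iidX.
have [N [A [v [mA tA vA cA]]]] := @cells_exist R B eta eta0.
(* The intersection cuts the unbounded last cell down to width at most [eta]. *)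
pose A' k := A k `&` `]-oo, B[%classic.
have mA' k : measurable (A' k) by apply: measurableI.
have tA' : trivIset setT A'.
  apply/trivIsetP => i j _ _ ij; rewrite /A' setIACA.
  by have /trivIsetP -> := tA; rewrite ?set0I.
have vA' k x : A' k x -> (v k <= x <= v k + eta)%R.
  move=> [/vA[vx xv]]; rewrite /= in_itv /= => xB.
  by rewrite vx /= (le_trans _ xv) // le_min lexx ltW.
pose E := cell_event X (fun _ : 'I_n => A').
have mE (f : {ffun 'I_n -> 'I_N}) : measurable (E f).
  by apply: (measurable_cell_event iidX) => i k; exact: mA'.
have posX w : 0 <= (expR (\sum_i t i * X i w))%:E by rewrite lee_fin expR_ge0.
have mU : measurable (\big[setU/set0]_(f : {ffun 'I_n -> 'I_N}) E f).
  by apply: bigsetU_measurable.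
apply: (@le_trans _ _ (\int[P]_(w in \big[setU/set0]_(f : {ffun 'I_n -> 'I_N}) E f)
    (expR (\sum_i t i * X i w))%:E)).
  apply: ge0_subset_integral => //; first exact: measurable_expR_dot.
  move=> w Dw.
  have [k Hk] : {k : 'I_n -> 'I_N & forall i, A' (k i) (X i w)}.
    apply: (@choice _ _ (fun i k => A' k (X i w))) => i; have /andP[BX XB] := DB w Dw i.
    by have [k Ak] := cA _ BX; exists k; split => //=; rewrite in_itv.
  rewrite -bigcup_seq /=; exists (finfun k) => //=; first by rewrite mem_index_enum.
  by move=> i _ /=; rewrite ffunE.
rewrite ge0_integral_bigsetU //; last 3 first.
- exact: index_enum_uniq.
- by apply: (sub_trivIset _ (trivIset_cell_event X _)) => // i; exact: tA'.
- exact: measurable_expR_dot.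
apply: (@le_trans _ _ (\sum_(f : {ffun 'I_n -> 'I_N})
    (\prod_i (expR (t i * v (f i) + `|t i| * eta) * fine (mu (A' (f i)))))%:E)).
  apply: lee_sum => f _; rewrite big_split /= EFinM.
  rewrite -(cell_event_prob (A := fun=> A') iidX (fun=> mA') f) -integral_cst //.
  apply: ge0_le_integral => //.
  - exact: measurable_expR_dot.
  move=> w Ew; rewrite lee_fin -expR_sum ler_expR; apply: ler_sum => i _.
  have /vA' /andP[vx xv] := Ew i I.
  have : (`|t i * (X i w - v (f i))| <= `|t i| * eta)%R.
    by rewrite normrM ler_wpM2l // ler_norml; apply/andP; split; lra.
  by rewrite ler_norml => /andP[_]; lra.
rewrite sumEFin lee_fin.
rewrite -(bigA_distr_bigA (fun i k => expR (t i * v k + `|t i| * eta) * fine (mu (A' k))))%R /=.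
rewrite mulr_sumr expR_sum -big_split /=; apply: ler_prod => i _.
apply/andP; split.
  by apply: sumr_ge0 => k _; rewrite mulr_ge0 ?expR_ge0 // fine_ge0.
rewrite [X in expR X](_ : _ = 2 * `|t i| * eta)%R; last by ring.
exact: laplace_cells_le.
Qed.

(** Boxes exhaust [Omega], so monotone convergence removes the box. This bounds [Lambda_n] from
    above, hence [Lstar_n] from below. *)
Lemma laplace_prod_le (t : 'I_n -> R) : (forall i, laplace mu (t i) < +oo) ->
  \int[P]_w (expR (\sum_i t i * X i w))%:E <=
  (\prod_i fine (laplace mu (t i)))%:E.
Proof.
move=> lt; have [mX _ _] := iidX.
set l := (\prod_i _)%R; set S := (\sum_i `|t i|)%R.
have l0 : (0 <= l)%R by apply: prodr_ge0 => i _; apply: fine_ge0; apply: laplace_ge0.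
have S0 : (0 <= S)%R by apply: sumr_ge0.
pose D (m : nat) : set Omega := \bigcap_(i in [set: 'I_n]) (X i @^-1` `[(- m%:R)%R, m%:R[%classic).
have mD m : measurable (D m).
  apply: fin_bigcap_measurable => [|i _]; first exact: finite_finset.
  by rewrite -[X in measurable X]setTI; exact: mX.
have DT : [set: Omega] = \bigcup_m D m.
  apply/esym/seteqP; split => // w _.
  exists (Num.trunc (\sum_i `|X i w|)%R).+1 => //= i _ /=; rewrite in_itv /=.
  have : (`|X i w| < (Num.trunc (\sum_i `|X i w|)%R).+1%:R)%R.
    have /truncn_itv /andP[_] : (0 <= \sum_i `|X i w|)%R by apply: sumr_ge0.
    apply: le_lt_trans; rewrite (bigD1 i) //= lerDl; exact: sumr_ge0.
  by rewrite ltr_norml => /andP[/ltW -> ->].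
have Dcvg : \int[P]_(w in D m) (expR (\sum_i t i * X i w))%:E @[m --> \oo] -->
    \int[P]_w (expR (\sum_i t i * X i w))%:E.
  rewrite DT; apply: ge0_nondecreasing_set_cvg_integral => //.
  - move=> m m' mm'; apply/subsetPset => w Dw i _; have := Dw i I.
    rewrite /= !in_itv /= => /andP[a b].
    have mm : (m%:R <= m'%:R :> R)%R by rewrite ler_nat.
    by apply/andP; split; [lra|exact: lt_le_trans mm].
  - by move=> m; exact: measurable_expR_dot.
rewrite -(cvg_lim _ Dcvg) //; apply: lime_le; first by apply/cvg_ex; eexists; exact: Dcvg.
near=> m; apply/lee_addgt0Pr => e e0.
(* Chosen so that the error factor is at most 1 + e/(l + 1), which adds at most el/(l + 1) <= e. *)
pose eta := (ln (1 + e / (l + 1)) / (2 * (S + 1)))%R.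
have el : (0 < e / (l + 1))%R by rewrite divr_gt0 // ltr_wpDl.
have eta0 : (0 < eta)%R.
  by rewrite divr_gt0 ?mulr_gt0 ?ltr_wpDl // ln_gt0 // ltrDl.
apply: le_trans (laplace_box_le t m%:R eta (D m) eta0 lt (mD m) _) _.
  by move=> w Dw i; have := Dw i I; rewrite /= in_itv.
rewrite -EFinD lee_fin.
have etaS : (2 * eta * S <= ln (1 + e / (l + 1)))%R.
  rewrite (_ : ln _ = 2 * eta * (S + 1))%R; last by rewrite /eta; field; lra.
  by apply: ler_wpM2l; lra.
apply: (@le_trans _ _ ((1 + e / (l + 1)) * l)%R).
  have pos : (0 < 1 + e / (l + 1))%R by lra.
  by apply: ler_wpM2r => //; rewrite -[leRHS]lnK ?posrE // ler_expR.
have : (l / (l + 1) <= 1)%R by rewrite ler_pdivrMr; lra.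
move/(ler_wpM2l (ltW e0)).
rewrite (_ : (1 + e / (l + 1)) * l = l + e * (l / (l + 1)))%R; last by ring.
by lra.
Unshelve. all: by end_near. Qed.

End laplace_product.

(** * Exponential tilting on a finite set *)

Section tilt.
Context {R : realType} {K : finType}.

(** From exp(-z) >= 1 - z one gets (1 - z)exp(z) <= 1, while (1 - z)(1 + z + 2z^2) = 1 + z^2(1 - 2z)
    >= 1. *)
Lemma expR_le_quadratic (z : R) : z <= 2^-1 -> expR z <= 1 + z + 2 * z ^+ 2.
Proof.
move=> z2; have := expR_ge1Dx (- z); rewrite expRN => H.
have e0 := expR_gt0 z.
have : (1 - z) * expR z <= 1 by rewrite -ler_pdivlMr // div1r.
have : 0 <= z ^+ 2 * (1 - 2 * z) by rewrite mulr_ge0 ?sqr_ge0 //; lra.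
move=> H1 H2; rewrite -(@ler_pM2l _ (1 - z)); last by lra.
by apply: (le_trans H2); rewrite -subr_ge0; move: H1; congr (_ <= _); ring.
Qed.

(** A first-order minimality condition without derivatives: with a negative mean, the quadratic
    bound would push the sum below 1 for small [s]. *)
Lemma mean_ge0_of_expR (q z : K -> R) (s0 : R) : (forall k, 0 <= q k) ->
  \sum_k q k = 1 -> 0 < s0 ->
  (forall s, 0 < s <= s0 -> 1 <= \sum_k q k * expR (s * z k)) ->
  0 <= \sum_k q k * z k.
Proof.
move=> q0 q1 s00 H; rewrite leNgt; apply/negP => D0.
set D := \sum_k _ in D0; pose Z := \sum_k `|z k| + 1.
have zZ k : `|z k| <= Z.
  by rewrite /Z (bigD1 k) //= -addrA lerDl addr_ge0 // sumr_ge0.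
have Z1 : 1 <= Z by rewrite /Z lerDr sumr_ge0.
have {Z1}Z0 : 0 < Z by lra.
clearbody Z.
(* The second bound makes the quadratic estimate applicable; the third keeps the quadratic term at
   most half of the linear one. *)
pose s := Num.min s0 (Num.min ((2 * Z)^-1) (- D / (4 * Z ^+ 2))).
have s_gt0 : 0 < s.
  by rewrite !lt_min s00 invr_gt0 mulr_gt0 //= divr_gt0 ?mulr_gt0 ?exprn_gt0 //; lra.
have sZ : s * Z <= 2^-1.
  by rewrite -ler_pdivlMr // -invfM !ge_min lexx !orbT.
have sD : s * (4 * Z ^+ 2) <= - D.
  by rewrite -ler_pdivlMr ?mulr_gt0 ?exprn_gt0 // !ge_min lexx !orbT.
have : 1 <= \sum_k q k * (1 + s * z k + 2 * (s * Z) ^+ 2).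
  apply: (le_trans (H s _)); first by rewrite s_gt0 ge_min lexx.
  apply: ler_sum => k _; apply: ler_wpM2l => //.
  have szk : `|s * z k| <= s * Z by rewrite normrM gtr0_norm // ler_wpM2l // ltW.
  apply: (le_trans (expR_le_quadratic _ _)).
    by apply: le_trans (ler_norm _) (le_trans szk sZ).
  rewrite lerD2l ler_pM2l // -ler_sqrt ?sqr_ge0 // !sqrtr_sqr.
  by rewrite [leRHS]ger0_norm // mulr_ge0 // ltW.
have -> : \sum_k q k * (1 + s * z k + 2 * (s * Z) ^+ 2) = 1 + s * D + 2 * (s * Z) ^+ 2.
  under eq_bigr do rewrite !mulrDr mulr1 mulrCA.
  by rewrite !big_split /= q1 -mulr_sumr -mulr_suml q1 mul1r.
have : s * (s * (4 * Z ^+ 2)) <= s * - D by rewrite ler_pM2l.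
have : s * D < 0 by rewrite pmulr_rlt0.
rewrite (_ : s * (s * (4 * Z ^+ 2)) = 4 * (s * Z) ^+ 2); last by ring.
by lra.
Qed.

(* The minimizer t0 of t |-> sum p e^{t(v-w)} on [0,T] is not T, so the tilted
   mean is at least w, with equality when t0 > 0. *)
Lemma tilt_exists (p v : K -> R) (w T c : R) : (forall k, 0 <= p k) ->
  \sum_k p k <= 1 -> 0 < T -> 1 < \sum_k p k * expR (T * (v k - w)) ->
  (forall t, 0 <= t <= T -> expR (- c) <= \sum_k p k * expR (t * (v k - w))) ->
  exists q l : K -> R, [/\ forall k, 0 <= q k, \sum_k q k = 1,
    forall k, p k = q k * expR (- l k), w <= \sum_k q k * v k &
    \sum_k q k * l k <= c].
Proof.
move=> p0 p1 T0 GT Gc; pose G t := \sum_k p k * expR (t * (v k - w)).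
have cG : {within `[0, T], continuous G}.
  apply: continuous_subspaceT; apply: continuous_big => [|k _]; first exact: add_continuous.
  move=> t; apply: cvgM; first exact: cvg_cst.
  apply: continuous_cvg; first exact: continuous_expR.
  by apply: cvgM; [exact: cvg_id|exact: cvg_cst].
have [t0 + tmin] := EVT_min (ltW T0) cG; rewrite in_itv /= => /andP[t00 t0T].
have G0 : 0 < G t0 by apply: lt_le_trans (Gc t0 _); rewrite ?expR_gt0 ?t00.
(* At [T] the sum exceeds 1, whereas at 0 it is the total mass of [p], at most 1. *)
have {}t0T : t0 < T.
  rewrite lt_neqAle t0T andbT; apply/eqP => t0T'.
  have := tmin 0; rewrite in_itv /= lexx ltW // => /(_ isT); rewrite t0T' leNgt => /negP; apply.
  apply: le_lt_trans GT; apply: le_trans p1; rewrite /G.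
  by apply: ler_sum => k _; rewrite mul0r expR0 mulr1.
pose q k := p k * expR (t0 * (v k - w)) / G t0.
have q0 k : 0 <= q k by rewrite divr_ge0 ?mulr_ge0 ?expR_ge0 // ltW.
have q1 : \sum_k q k = 1 by rewrite -mulr_suml divff // gt_eqF.
(* G(t0 + s)/G(t0) is the moment generating function of [v - w] under [q], so minimality at [t0]
   bounds it below by 1. *)
have qshift s : 0 <= t0 + s <= T -> 1 <= \sum_k q k * expR (s * (v k - w)).
  move=> ts; have Gs : G t0 <= G (t0 + s) by apply: tmin; rewrite in_itv.
  apply: (@le_trans _ _ (G (t0 + s) / G t0)); first by rewrite ler_pdivlMr // mul1r.
  rewrite [X in X / _]/G mulr_suml; apply: ler_sum => k _; rewrite /q mulrDl expRD.
  by rewrite le_eqVlt; apply/orP; left; apply/eqP; ring.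
have mean_ge : 0 <= \sum_k q k * (v k - w).
  apply: (mean_ge0_of_expR q _ (T - t0)) => //; first by rewrite subr_gt0.
  by move=> s /andP[s0 sT]; apply: qshift; lra.
(* Complementary slackness: if [t0 > 0], shifts to the left are allowed too, and the mean of [v - w]
   vanishes. *)
have mean_eq : t0 * \sum_k q k * (v k - w) = 0.
  move: t00; rewrite le_eqVlt => /orP[/eqP <-|t0gt]; first by rewrite mul0r.
  rewrite (_ : \sum_k q k * (v k - w) = 0) ?mulr0 //; apply/eqP; rewrite eq_le mean_ge andbT.
  rewrite -oppr_ge0 -sumrN; under eq_bigr do rewrite -mulrN.
  apply: (mean_ge0_of_expR q _ t0) => // s /andP[s0 st].
  under eq_bigr do rewrite mulrN -mulNr.
  by apply: qshift; lra.
(* This is the log-density of [q] with respect to [p]; by [mean_eq] its [q]-mean is -ln G(t0). *)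
exists q, (fun k => t0 * (v k - w) - ln (G t0)); split => //.
- move=> k; rewrite opprB expRD lnK ?posrE // /q expRN.
  by field; rewrite !gt_eqF ?expR_gt0.
- rewrite -subr_ge0 -[X in _ - X]mul1r -q1 mulr_suml -sumrB.
  by under eq_bigr do rewrite -mulrBr.
under eq_bigr do rewrite mulrBr mulrCA.
rewrite sumrB -mulr_sumr mean_eq -mulr_suml q1 mul1r sub0r lerNl.
by rewrite -ler_expR lnK ?posrE //; apply: Gc; rewrite t00 ltW.
Qed.

End tilt.

(** * Truncated Laplace transforms, uniformly on compact sets of parameters *)

Section uniform_laplace.
Context {R : realType} (mu : probability R R).
Hypothesis mu_even : even_measure mu.
Local Open Scope ereal_scope.

(* Uniformity in t holds for this lower bound, by compactness and lower
   semicontinuity, but not for the convergence to laplace mu t, which may jump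
   to +oo. *)
Lemma truncated_laplace_ge (y T e : R) : Lstar mu y < +oo -> (0 < e)%R ->
  \forall m \near \oo, forall t, (0 <= t <= T)%R ->
    (expR (t * y - fine (Lstar mu y) - e))%:E <=
    \int[mu]_(x in `[(- m%:R)%R, m%:R[) (expR (t * x))%:E.
Proof.
move=> Ly e0; set L := fine _.
pose I (m : nat) t := \int[mu]_(x in `[(- m%:R)%R, m%:R[) (expR (t * x))%:E.
have Inneg m t : 0 <= I m t by apply: integral_ge0 => x _; rewrite lee_fin expR_ge0.
have Isub m m' : (m <= m')%N ->
    `[(- m%:R)%R, m%:R[%classic `<=` (`[(- m'%:R)%R, m'%:R[%classic : set R).
  move=> mm' x; rewrite /= !in_itv /= => /andP[a b].
  have mm : (m%:R <= m'%:R :> R)%R by rewrite ler_nat.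
  by apply/andP; split; [lra|exact: lt_le_trans mm].
have Imono m m' t : (m <= m')%N -> I m t <= I m' t.
  move=> mm'; apply: ge0_subset_integral => //; first exact: measurable_expR_mul.
  exact: Isub.
have Icvg t : I m t @[m --> \oo] --> laplace mu t.
  rewrite /laplace (_ : [set: R] = \bigcup_m `[(- m%:R)%R, m%:R[%classic).
    apply: ge0_nondecreasing_set_cvg_integral => //.
      by move=> m m' /Isub mm'; apply/subsetPset.
    by move=> m; exact: measurable_expR_mul.
  apply/esym/seteqP; split => // x _.
  exists (Num.trunc `|x|%R).+1 => //=; rewrite in_itv /=.
  by have /truncn_itv/andP[_] := normr_ge0 x; rewrite ltr_norml => /andP[/ltW -> ->].
have cpt := @segment_compact R 0%R T.
move/compact_near_coveringP : cpt => /(_ nat \oo (fun m t =>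
  (expR (t * y - L - e))%:E <= I m t)) H.
have {}H := H _; apply: filterS (H _ _) => [m Hm t t0T|].
  by apply: Hm; rewrite /= in_itv.
move=> t; rewrite /= => _.
have [m0 Im0] : exists m0, (expR (t * y - L - e / 2))%:E <= I m0 t.
  apply/not_existsP => Hn.
  have : laplace mu t <= (expR (t * y - L - e / 2))%:E.
    rewrite -(cvg_lim _ (Icvg t)) //; apply: lime_le; first by apply/cvg_ex; eexists; exact: Icvg.
    by near=> m; rewrite ltW // ltNge; apply/negP/Hn.
  apply/negP; rewrite -ltNge; apply: lt_le_trans (laplace_ge _ mu_even _ _ Ly).
  by rewrite lte_fin ltr_expR -/L; lra.
(* Moving [t] to [t'] costs at most [|t - t'| * m0] in the integrand and [|t - t'| * |y|] in the
   target; the chosen radius keeps the total below [e / 2]. *)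
pose C := (m0%:R + `|y| + 1)%R : R; have C0 : (0 < C)%R by rewrite ltr_wpDl // addr_ge0.
exists (ball t (e / 2 / C)%R, [set m | (m0 <= m)%N]) => /=.
  split; first by apply: nbhsx_ballx; rewrite !divr_gt0.
  by exists m0.
move=> [t' m] [/= tt' m0m]; apply: le_trans (Imono m0 m t' m0m).
have {}tt' : (`|t - t'| * C < e / 2)%R by rewrite -ltr_pdivlMr.
apply: (@le_trans _ _ ((expR (- (`|t - t'| * m0%:R)))%:E * I m0 t)); last first.
  rewrite -ge0_integralZl_EFin ?expR_ge0 //; last exact: measurable_expR_mul.
  apply: ge0_le_integral => //.
  - by apply: measurable_funeM; exact: measurable_expR_mul.
  - exact: measurable_expR_mul.
  move=> x; rewrite /= in_itv /= => /andP[mx xm].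
  rewrite -EFinM lee_fin -expRD ler_expR.
  have : (`|(t - t') * x| <= `|t - t'| * m0%:R)%R.
    by rewrite normrM ler_wpM2l // ler_norml mx ltW.
  by rewrite ler_norml => /andP[_]; lra.
apply: (@le_trans _ _
  ((expR (- (`|t - t'| * m0%:R)))%:E * (expR (t * y - L - e / 2))%:E)); last first.
  by rewrite lee_pmul2l // lte_fin expR_gt0.
rewrite -EFinM lee_fin -expRD ler_expR.
have : (`|(t - t') * y| <= `|t - t'| * `|y|)%R by rewrite normrM.
rewrite ler_norml => /andP[+ _].
by move: tt'; rewrite /C !mulrDr; have := normr_ge0 (t - t')%R; lra.
Unshelve. all: by end_near. Qed.

End uniform_laplace.

(** * Finitely many tilts serving all y in [0, M] *)

Section uniform_tilt.
Context {R : realType} (mu : probability R R).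
Hypothesis mu_even : even_measure mu.

Lemma fin_cover_measure_le (N : nat) (A : 'I_N -> set R) (S : pred 'I_N) (D : set R) :
  (forall k, measurable (A k)) -> trivIset setT A -> measurable D ->
  (forall x, D x -> exists2 k, S k & A k x) ->
  fine (mu D) <= \sum_(k | S k) fine (mu (A k)).
Proof.
move=> mA tA mD DA; rewrite -lee_fin -sumEFin fineK ?fin_num_measure //.
under eq_bigr do rewrite fineK ?fin_num_measure //.
rewrite -big_filter; set s := [seq _ <- _ | _].
have us : uniq s by rewrite filter_uniq // index_enum_uniq.
rewrite (fsbig_seq _ _ us) -measure_fin_bigcup //; last exact: (sub_trivIset _ tA).
apply: le_measure; rewrite ?inE //; first exact: fin_bigcup_measurable.
move=> x /DA[k Sk Ak]; exists k => //=.
by rewrite mem_filter Sk mem_index_enum.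
Qed.

Lemma sum_disjoint_measure_le1 (N : nat) (A : 'I_N -> set R) :
  (forall k, measurable (A k)) -> trivIset setT A ->
  \sum_k fine (mu (A k)) <= 1.
Proof.
move=> mA tA; rewrite -lee_fin -sumEFin.
under eq_bigr do rewrite fineK ?fin_num_measure //.
rewrite (fsbig_seq _ _ (index_enum_uniq _)) -measure_fin_bigcup //.
  exact: probability_le1 (fin_bigcup_measurable _ _).
exact: (sub_trivIset _ tA).
Qed.

Lemma truncated_laplace_le_cells (N : nat) (A : 'I_N -> set R) (v : 'I_N -> R)
    (B eta t : R) :
  (forall k, measurable (A k)) -> trivIset setT A ->
  (forall k x, A k x -> v k <= x /\ Num.min x B <= v k + eta) ->
  (forall x, - B <= x -> exists k, A k x) -> 0 <= t ->
  (\int[mu]_(x in `[(- B)%R, B[) (expR (t * x))%:E <=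
   (\sum_k fine (mu (A k)) * expR (t * (v k + eta)))%:E)%E.
Proof.
move=> mA tA vA cA t0.
pose A' k := A k `&` `[(- B)%R, B[%classic.
have mA' k : measurable (A' k) by apply: measurableI.
have -> : `[(- B)%R, B[%classic = \big[setU/set0]_(k < N) A' k.
  rewrite -bigcup_seq; apply/seteqP; split => x.
    rewrite /= in_itv /= => xB; have /andP[Bx _] := xB.
    by have [k Ak] := cA _ Bx; exists k; [rewrite /= mem_index_enum|split].
  by move=> [k _ []].
rewrite ge0_integral_bigsetU //; last 3 first.
- exact: index_enum_uniq.
- apply/trivIsetP => i j _ _ ij; rewrite /A' setIACA.
  by have /trivIsetP -> := tA; rewrite ?set0I.
- exact: measurable_expR_mul.
rewrite -sumEFin; apply: lee_sum => k _.
apply: (@le_trans _ _ (\int[mu]_(x in A' k) (expR (t * (v k + eta)))%:E)%E).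
  apply: ge0_le_integral => //; first exact: measurable_expR_mul.
  move=> x [/vA[_ xv]]; rewrite /= in_itv /= => /andP[_ xB].
  by rewrite lee_fin ler_expR ler_wpM2l // (le_trans _ xv) // le_min lexx ltW.
rewrite integral_cst // EFinM muleC fineK ?fin_num_measure //.
rewrite lee_pmul2r // ?lte_fin ?expR_gt0 //.
by apply: le_measure; rewrite ?inE //; exact: subIsetl.
Qed.

(** Each [y] is rounded down to a multiple j delta, and the tilt aims at mean (j + 2) delta, which
    is at least [y + delta]. Monotonicity of [Lstar] transfers the entropy bound to [y], and
    finiteness of the grid gives a common truncation and a common [C]. *)
Lemma uniform_tilt (M b e : R) : 0 <= M -> M < b ->
  (0 < mu `[b, +oo[%classic)%E -> 0 < e ->
  exists (N : nat) (A : 'I_N -> set R) (v : 'I_N -> R) (delta C : R),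
  [/\ 0 < delta, forall k, measurable (A k), trivIset setT A,
    forall k, (forall x, A k x -> v k <= x) /\ `|v k| <= C &
    forall y, 0 <= y <= M -> exists q l : 'I_N -> R,
    [/\ forall k, 0 <= q k, \sum_k q k = 1,
      forall k, fine (mu (A k)) = q k * expR (- l k) /\ `|l k| <= C,
      y + delta <= \sum_k q k * v k &
      \sum_k q k * l k <= fine (Lstar mu y) + e]].
Proof.
move=> M0 Mb tail_b e0.
have Ly y : 0 <= y <= M -> (Lstar mu y < +oo)%E.
  move=> /andP[y0 yM]; apply: le_lt_trans (ltry _).
  apply: (Lstar_le_tail _ mu_even _ y0); apply: lt_le_trans tail_b _.
  apply: le_measure; rewrite ?inE // => x /=; rewrite !in_itv /= !andbT.
  by apply: le_trans; lra.
set p0 := fine (mu `[b, +oo[%classic).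
have p0_gt0 : 0 < p0 by rewrite -lte_fin fineK ?fin_num_measure.
have p0_le1 : p0 <= 1 by rewrite -lee_fin fineK ?fin_num_measure // probability_le1.
pose g := (b - M) / 3; have g0 : 0 < g by rewrite divr_gt0 // subr_gt0.
(* Cells with [v k >= b - g] lie at least [g] above the target mean and carry mass at least [p0].
   This [T] gives p0 exp(Tg) = exp(1) > 1, as [tilt_exists] requires. *)
pose T := (1 - ln p0) / g.
have T0 : 0 < T by rewrite divr_gt0 // ltrBrDr add0r; have := ln_le0 p0_le1; lra.
have gE : 3 * g = b - M by rewrite /g; lra.
have TE : T * g = 1 - ln p0 by rewrite /T divfK // gt_eqF.
clearbody T g.
(* Two steps for the target and one for the cell width cost at most 3T delta <= e/2, which together
   with the truncation loss e/3 stays below [e]. *)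
pose delta := Num.min (g / 2) (e / (6 * T)).
have delta0 : 0 < delta by rewrite lt_min !divr_gt0 //; lra.
have delta_g : 2 * delta <= g.
  have : delta <= g / 2 by rewrite ge_min lexx.
  by lra.
have delta_T : T * delta <= e / 6.
  have : delta <= e / (6 * T) by rewrite ge_min lexx orbT.
  by rewrite ler_pdivlMr ?mulr_gt0 // => H; rewrite ler_pdivlMr //; lra.
clearbody delta.
pose J := (Num.trunc (M / delta)).+1.
have yJ (j : 'I_J) : 0 <= j%:R * delta <= M.
  rewrite mulr_ge0 ?(ltW delta0) //= -ler_pdivlMr //.
  have /truncn_itv/andP[+ _] : 0 <= M / delta by rewrite divr_ge0 // ltW.
  by apply: le_trans; rewrite ler_nat -ltnS.
have e3 : 0 < e / 3 by rewrite divr_gt0.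
(* Requiring [b <= m] ensures that every cell meeting [b, +oo) has left endpoint at least
   [b - delta]. *)
have [m [Hm mb]] : exists m : nat, (forall (j : 'I_J) t, 0 <= t <= T ->
    ((expR (t * (j%:R * delta) - fine (Lstar mu (j%:R * delta)) - e / 3))%:E <=
    \int[mu]_(x in `[(- m%:R)%R, m%:R[) (expR (t * x))%:E)%E) /\ b <= m%:R.
  near \oo => m; exists m; split; last first.
    by near: m; exact: nbhs_infty_ger.
  near: m; apply: filter_forall => j.
  exact: (truncated_laplace_ge _ mu_even _ _ _ (Ly _ (yJ j)) e3).
have [N [A [v [mA tA vA cA]]]] := @cells_exist R m%:R delta delta0.
pose p k := fine (mu (A k)).
have p_ge0 k : 0 <= p k by apply: fine_ge0.
have tilt (j : 'I_J) : exists ql : ('I_N -> R) * ('I_N -> R),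
    [/\ forall k, 0 <= ql.1 k, \sum_k ql.1 k = 1,
      forall k, p k = ql.1 k * expR (- ql.2 k),
      j%:R * delta + 2 * delta <= \sum_k ql.1 k * v k &
      \sum_k ql.1 k * ql.2 k <= fine (Lstar mu (j%:R * delta)) + e].
  set w := j%:R * delta + 2 * delta.
  have /andP[yj0 yjM] := yJ j.
  have [|t t0T|q [l [? ? ? ? ?]]] := tilt_exists p v w T
      (fine (Lstar mu (j%:R * delta)) + e) p_ge0 (sum_disjoint_measure_le1 _ _ mA tA) T0.
  - have cover : p0 <= \sum_(k | b - g <= v k) p k.
      apply: (fin_cover_measure_le _ _ (fun k => b - g <= v k)) => // x.
      rewrite /= in_itv /= andbT => bx.
      have [k Ak] : exists k, A k x by apply: cA; lra.
      exists k => //; have [_ xv] := vA _ _ Ak.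
      have : b <= Num.min x m%:R by rewrite le_min bx.
      by lra.
    have : p0 * expR (T * g) <= \sum_k p k * expR (T * (v k - w)).
      rewrite [leRHS](bigID (fun k => b - g <= v k)) /=.
      rewrite -[leLHS]addr0; apply: lerD; last first.
        by apply: sumr_ge0 => k _; rewrite mulr_ge0 ?expR_ge0.
      apply: (@le_trans _ _ (\sum_(k | b - g <= v k) p k * expR (T * g))).
        by rewrite -mulr_suml ler_wpM2r ?expR_ge0.
      apply: ler_sum => k vk; rewrite ler_wpM2l // ler_expR ler_wpM2l ?(ltW T0) //.
      by rewrite /w; lra.
    apply: lt_le_trans; rewrite TE expRD expRN lnK ?posrE //.
    rewrite mulrCA divff ?gt_eqF // mulr1.
    by have := @expR_gt1 R 1; rewrite ltr01.
  - have tle : t * delta <= e / 6.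
      by apply: le_trans delta_T; rewrite ler_wpM2r ?(ltW delta0) //; case/andP: t0T.
    have /andP[t0 _] := t0T.
    have := le_trans (Hm j t t0T) (truncated_laplace_le_cells _ _ _ _ _ _ mA tA vA cA t0).
    rewrite lee_fin -(@ler_pM2r _ (expR (- (t * (w + delta))))) ?expR_gt0 //.
    rewrite mulr_suml -expRD => H; apply: (le_trans (le_trans _ H)).
      by rewrite ler_expR /w; lra.
    apply: ler_sum => k _; rewrite -mulrA -expRD.
    by apply: ler_wpM2l; [exact: p_ge0|rewrite ler_expR; lra].
  by exists (q, l).
have [ql Hql] := choice tilt.
pose C1 := \sum_k `|v k|; pose C2 := \sum_j \sum_k `|(ql j).2 k|.
have C1_ge0 : 0 <= C1 by apply: sumr_ge0.
have C2_ge0 : 0 <= C2 by apply: sumr_ge0 => j _; apply: sumr_ge0.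
exists N, A, v, delta, (C1 + C2); split => //.
  move=> k; split; first by move=> x /vA[].
  have : `|v k| <= C1 by rewrite /C1 (bigD1 k) //= lerDl sumr_ge0.
  by lra.
move=> y /andP[y0 yM].
have yd0 : 0 <= y / delta by rewrite divr_ge0 // ltW.
have jJ : (Num.trunc (y / delta) < J)%N.
  rewrite ltnS; apply: le_truncn; rewrite ler_pM2r ?invr_gt0 //.
have := truncn_itv yd0; rewrite ler_pdivlMr // ltr_pdivrMr //.
rewrite -natr1 mulrDl mul1r => /andP[jy yj].
have [q0 q1 pq qv ql_le] := Hql (Ordinal jJ).
exists (ql (Ordinal jJ)).1, (ql (Ordinal jJ)).2; split => //.
- move=> k; split; first exact: pq.
  have : `|(ql (Ordinal jJ)).2 k| <= C2.
    rewrite /C2 (bigD1 (Ordinal jJ)) //= (bigD1 k) //= -addrA lerDl addr_ge0 //.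
      exact: sumr_ge0.
    by apply: sumr_ge0 => i _; apply: sumr_ge0.
  by lra.
- by apply: le_trans qv => /=; lra.
apply: (le_trans ql_le); rewrite lerD2r; apply: fine_le.
- by rewrite ge0_fin_numE ?Lstar_ge0 // Ly.
- by rewrite ge0_fin_numE ?Lstar_ge0 // Ly // y0.
by apply: le_Lstar => //=; rewrite jy mulr_ge0 // ltW.
Unshelve. all: by end_near. Qed.

End uniform_tilt.

(** * From n-dimensional data to single coordinates *)

Section reductions.
Context {R : realType} (mu : probability R R).
Context d (Omega : measurableType d) (P : probability Omega R) (n : nat)
  (X : 'I_n -> Omega -> R).
Hypothesis iidX : iid_law P X mu.
Hypothesis mu_even : even_measure mu.

Lemma integral_expR_gt0 (g : Omega -> R) : measurable_fun setT g ->
  (0 < \int[P]_w (expR (g w))%:E)%E.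
Proof.
move=> mg; have mexp : measurable_fun setT (fun w => (expR (g w))%:E).
  by apply/measurable_EFinP; apply: (measurableT_comp (@measurable_expR R)).
rewrite lt_neqAle integral_ge0 ?andbT; last by move=> w _; rewrite lee_fin expR_ge0.
apply/eqP => /esym int0.
have : ae_eq P setT (fun w => (expR (g w))%:E) (cst 0%E).
  apply/ae_eq_integral_abs => //; rewrite -[RHS]int0.
  by apply: eq_integral => w _; rewrite gee0_abs // lee_fin expR_ge0.
case=> N [mN N0 sub].
have NT : N = setT.
  apply/seteqP; split => // w _; apply: sub => /= /(_ I) [] /eqP.
  by rewrite gt_eqF // expR_gt0.
have /eqP : 1%E = 0%E :> \bar R by rewrite -N0 NT; exact/esym/probability_setT.
by rewrite onee_eq0.
Qed.

Lemma dotv_row_le (x : 'rV[R]_n) (r : R) (t : 'I_n -> R) :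
  (Lstar_n P X x <= r%:E)%E -> (forall i, laplace mu (t i) < +oo)%E ->
  \sum_i (t i * x ord0 i - ln (fine (laplace mu (t i)))) <= r.
Proof.
move=> xr lt; have [mX _ _] := iidX.
have l_gt0 i : 0 < fine (laplace mu (t i)).
  by rewrite fine_gt0 // laplace_gt0 ?lt.
have : ((dotv x (\row_i t i))%:E - Lambda_n P X (\row_i t i) <= r%:E)%E.
  by apply: le_trans xr; apply: ereal_sup_ubound; exists (\row_i t i).
have -> : dotv x (\row_i t i) = \sum_i t i * x ord0 i.
  by apply: eq_bigr => i _; rewrite mxE mulrC.
rewrite /Lambda_n.
have dotE w : dotv (\row_i t i) (randvec X w) = \sum_i t i * X i w.
  by apply: eq_bigr => i _; rewrite !mxE.
under eq_integral do rewrite dotE.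
have := laplace_prod_le mu _ _ P _ X iidX t lt.
have : (0 < \int[P]_w (expR (\sum_i t i * X i w))%:E)%E.
  by apply: integral_expR_gt0; apply: measurable_sum => i; exact: measurable_funM.
case: (\int[P]_w _)%E => [l| |] //=; rewrite lte_fin lee_fin => l0 ll.
rewrite -EFinB lee_fin => H; rewrite sumrB.
apply: le_trans H; rewrite lerD2l lerN2 -ler_expR expR_sum lnK ?posrE //.
apply: (le_trans ll); rewrite le_eqVlt; apply/orP; left; apply/eqP/eq_bigr => i _.
by rewrite lnK ?posrE.
Qed.

(** Near-optimal parameters for each coordinate are combined into one vector tested in [Lstar_n]. *)
Lemma Bball_sum_Lstar (x : 'rV[R]_n) (r : R) : (Lstar_n P X x <= r%:E)%E ->
  (forall i, Lstar mu (x ord0 i) < +oo)%E /\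
  \sum_i fine (Lstar mu (x ord0 i)) <= r.
Proof.
move=> xr.
have laplace0 : laplace mu 0 = 1%E.
  rewrite /laplace; under eq_integral do rewrite mul0r expR0.
  by rewrite integral_cst // mul1e; exact: probability_setT.
have Lr i : (Lstar mu (x ord0 i) <= r%:E)%E.
  apply: ub_ereal_sup => _ [t _ <-]; rewrite /Lambda.
  have := laplace_gt0 _ mu_even t.
  have [lt _|] := boolP (laplace mu t == +oo)%E; first by rewrite leNye.
  rewrite -ltey => lt l0.
  (* A vector supported on one coordinate first shows that each [Lstar] is finite. *)
  have := dotv_row_le x r (fun j => if j == i then t else 0) xr.
  rewrite (bigD1 i) //= eqxx big1 ?addr0.
    by rewrite -EFinB lee_fin; apply => j; case: eqP => // _; rewrite laplace0 ltry.
  by move=> j /negbTE ->; rewrite laplace0 /= mul0r ln1 subr0.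
have Loo i : (Lstar mu (x ord0 i) < +oo)%E by apply: le_lt_trans (Lr i) (ltry _).
split => //.
have Lfin i : Lstar mu (x ord0 i) \is a fin_num by rewrite ge0_fin_numE ?Lstar_ge0.
(* The denominator n + 1 also covers n = 0. *)
apply/ler_addgt0Pr => e e0; pose e' := e / n.+1%:R.
have e'0 : 0 < e' by rewrite divr_gt0.
have H i : exists t, (laplace mu t < +oo)%E /\
    fine (Lstar mu (x ord0 i)) - e' <= t * x ord0 i - ln (fine (laplace mu t)).
  have [_ [t _ <-]] := ub_ereal_sup_adherent e'0 (Lfin i).
  rewrite -[X in (X - _)%E](fineK (Lfin i)) /Lambda.
  have [//|] := boolP (laplace mu t == +oo)%E.
  rewrite -ltey => lt; rewrite -!EFinB lte_fin => /ltW le.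
  by exists t.
have [t Ht] := choice H.
have := dotv_row_le x r t xr (fun i => (Ht i).1).
move=> tr; rewrite -lerBlDr; apply: le_trans tr.
apply: (@le_trans _ _ (\sum_i (fine (Lstar mu (x ord0 i)) - e'))).
  rewrite sumrB sumr_const card_ord lerD2l lerN2 -[leLHS]mulr_natr /e'.
  by rewrite mulrAC ler_pdivrMr // ler_pM2l // ler_nat.
by apply: ler_sum => i _; exact: (Ht i).2.
Qed.

(** Evenness allows the normal vector of a half-space to be made nonnegative coordinate by
    coordinate. *)
Lemma iid_law_flip (s : 'I_n -> bool) :
  iid_law P (fun i w => if s i then - X i w else X i w) mu.
Proof.
have [mX lawX indX] := iidX.
pose A' (A : 'I_n -> set R) i := if s i then (fun x => - x) @^-1` A i else A i.
have mA' A : (forall i, measurable (A i)) -> forall i, measurable (A' A i).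
  move=> mA i; rewrite /A'; case: (s i) => //.
  by rewrite -[X in measurable X]setTI; exact: oppr_measurable.
have preE A i : (fun w => if s i then - X i w else X i w) @^-1` A i = X i @^-1` A' A i.
  by rewrite /A'; case: (s i).
split.
- by move=> i; case: (s i) => //; exact: measurable_funN.
- move=> i A mA; rewrite (preE (fun=> A)) lawX; last exact: mA'.
  by rewrite /A'; case: (s i) => //; exact: mu_even.
move=> A mA; rewrite (eq_bigcapr (fun i _ => preE A i)) indX; last exact: mA'.
by apply: eq_bigr => i _; rewrite preE.
Qed.

End reductions.

(** * Combining tilts of single coordinates into a half-space bound *)

Section cell_data.
Context {R : realType} (mu : probability R R) {K : finType}.
Implicit Types (B : K -> set R) (v q l : K -> R).

Lemma variance_le q v (C : R) : (forall k, 0 <= q k) -> \sum_k q k = 1 ->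
  (forall k, `|v k| <= C) ->
  \sum_k q k * (v k - \sum_j q j * v j) ^+ 2 <= C ^+ 2.
Proof.
move=> q0 q1 vC; set m := \sum_j q j * v j.
have -> : \sum_k q k * (v k - m) ^+ 2 = \sum_k q k * v k ^+ 2 - m ^+ 2.
  transitivity (\sum_k (q k * v k ^+ 2 - 2 * m * (q k * v k) + q k * m ^+ 2)).
    by apply: eq_bigr => k _; ring.
  by rewrite big_split sumrB /= -mulr_sumr -mulr_suml q1 -/m; ring.
rewrite lerBlDr -[leLHS]addr0 lerD ?sqr_ge0 //.
rewrite -[leRHS]mul1r -q1 mulr_suml; apply: ler_sum => k _.
rewrite ler_wpM2l // -ler_sqrt ?sqr_ge0 // !sqrtr_sqr.
by rewrite (le_trans (vC k)) // ler_norm.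
Qed.

(* A tilt q of the law of one coordinate discretized along B: its mean is at
   least y + delta, its relative entropy at most c, and C^2, tau bound the
   variances of its log-likelihood l and of its values v. *)
Definition cell_data (y delta c C tau : R) B v q l : Prop :=
  [/\ [/\ forall k, measurable (B k), trivIset setT B,
        forall k x, B k x -> v k <= x &
        forall k, fine (mu (B k)) = q k * expR (- l k)],
      (forall k, 0 <= q k) /\ \sum_k q k = 1,
      y + delta <= \sum_k q k * v k,
      \sum_k q k * l k <= c &
      \sum_k q k * (l k - \sum_j q j * l j) ^+ 2 <= C ^+ 2 /\
      \sum_k q k * (v k - \sum_j q j * v j) ^+ 2 <= tau].

(** The tilt is conditioning on [z, +oo): all mass sits on the index [k0], the other cells are
    empty, and both variances vanish because [v] and [l] are constant. *)
Lemma half_line_data (k0 : K) (y z delta c C : R) : (0 < mu `[z, +oo[%classic)%E ->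
  y + delta <= z -> - ln (fine (mu `[z, +oo[%classic)) <= c ->
  exists B v q l, cell_data y delta c C 0 B v q l.
Proof.
move=> tail_z yz zc.
exists (fun k => if k == k0 then `[z, +oo[%classic else set0), (fun=> z),
  (fun k => (k == k0)%:R), (fun=> - ln (fine (mu `[z, +oo[%classic))).
have sum1 (w : R) : \sum_k (k == k0)%:R * w = w.
  by rewrite (bigD1 k0) //= eqxx mul1r big1 ?addr0 // => k /negbTE ->; rewrite mul0r.
split.
- split.
  + by move=> k; case: ifP.
  + apply/trivIsetP => i j _ _ ij; apply/seteqP; split => // x /=.
    have [ik|_] := eqVneq i k0; have [jk|_] := eqVneq j k0; move=> [] //.
    by move: ij; rewrite ik jk eqxx.
  + by move=> k x; case: ifP => //= _; rewrite in_itv /= andbT.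
  + move=> k; case: ifP => _; last by rewrite measure0 mul0r.
    by rewrite mul1r opprK lnK // posrE -lte_fin fineK ?fin_num_measure.
- split=> [k|]; first exact: ler0n.
  by under eq_bigr do rewrite -[_%:R]mulr1; rewrite sum1.
- by rewrite sum1.
- by rewrite sum1.
- by rewrite !sum1 !subrr expr0n sqr_ge0.
Qed.

(** Transfers [tilted_sum_ge] to [P] by replacing each X_i by the lower value of its cell. The bound
    [tau] may vary with [i], so that coordinates handled by conditioning add no variance to the
    weighted sum. *)
Lemma weighted_sum_prob_ge d (Omega : measurableType d) (P : probability Omega R)
    (n : nat) (X : 'I_n -> Omega -> R) (a y delta c tau : 'I_n -> R) (C s : R)
    (D : set Omega) :
  iid_law P X mu ->
  (forall i, exists B v q l, cell_data (y i) (delta i) (c i) C (tau i) B v q l) ->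
  (forall i, 0 <= a i) -> (forall i, 0 <= delta i) -> 0 <= s ->
  n%:R * C ^+ 2 <= s ^+ 2 / 4 ->
  \sum_i a i ^+ 2 * tau i <= (\sum_i a i * delta i) ^+ 2 / 4 ->
  measurable D ->
  (forall w, \sum_i a i * y i <= \sum_i a i * X i w -> D w) ->
  ((expR (- (\sum_i c i) - s) / 2)%:E <= P D)%E.
Proof.
move=> iidX data a0 delta0 s0 nC atau mD HD.
have {data}data i : exists z : ((K -> set R) * (K -> R)) * ((K -> R) * (K -> R)),
    cell_data (y i) (delta i) (c i) C (tau i) z.1.1 z.1.2 z.2.1 z.2.2.
  by have [B [v [q [l H]]]] := data i; exists ((B, v), (q, l)).
have [z Hz] := choice data.
pose B i := (z i).1.1; pose v i := (z i).1.2.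
pose q i := (z i).2.1; pose l i := (z i).2.2.
have mB i k : measurable (B i k).
  by have [[H _ _ _] _ _ _ _] := Hz i; exact: H.
have tB i : trivIset setT (B i) by have [[_ H _ _] _ _ _ _] := Hz i.
have vB i k x : B i k x -> v i k <= x.
  by have [[_ _ H _] _ _ _ _] := Hz i; exact: H.
have pB i k : fine (mu (B i k)) = q i k * expR (- l i k).
  by have [[_ _ _ H] _ _ _ _] := Hz i; exact: H.
have q0 i k : 0 <= q i k by have [_ [H _] _ _ _] := Hz i; exact: H.
have q1 i : \sum_k q i k = 1 by have [_ [_ H] _ _ _] := Hz i.
have mean i : y i + delta i <= \sum_k q i k * v i k by have [_ _ H _ _] := Hz i.
have drift : \sum_i a i * delta i <= \sum_i a i * (\sum_k q i k * v i k - y i).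
  by apply: ler_sum => i _; rewrite ler_wpM2l // lerBrDl.
have drift0 : 0 <= \sum_i a i * delta i by apply: sumr_ge0 => i _; rewrite mulr_ge0.
have varl : \sum_i \sum_k q i k * (l i k - \sum_j q i j * l i j) ^+ 2 <= s ^+ 2 / 4.
  apply: le_trans nC; rewrite mulr_natl -[n in _ *+ n]card_ord -sumr_const.
  by apply: ler_sum => i _; have [_ _ _ _ []] := Hz i.
have varv : \sum_i a i ^+ 2 * (\sum_k q i k * (v i k - \sum_j q i j * v i j) ^+ 2) <=
    (\sum_i a i * (\sum_k q i k * v i k - y i)) ^+ 2 / 4.
  apply: (@le_trans _ _ (\sum_i a i ^+ 2 * tau i)).
    by apply: ler_sum => i _; rewrite ler_wpM2l ?sqr_ge0 //; have [_ _ _ _ []] := Hz i.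
  apply: (le_trans atau); rewrite ler_pM2r ?invr_gt0 // lerXn2r ?nnegrE //.
  exact: le_trans drift.
have H := tilted_sum_ge q q0 q1 (fun i k => fine (mu (B i k))) l v a y s pB s0
  varl (le_trans drift0 drift) varv.
apply: (@le_trans _ _ (\sum_(f : {ffun 'I_n -> K} | \sum_i a i * y i <= \sum_i a i * v i (f i))
     \prod_i fine (mu (B i (f i))))%:E); last first.
  apply: (cell_event_sum_le iidX mB tB) => // f af w fw; apply: HD.
  apply: (le_trans af); apply: ler_sum => i _; rewrite ler_wpM2l //.
  by apply: (vB i (f i)); exact: fw.
rewrite lee_fin; apply: le_trans H.
rewrite ler_pM2r ?invr_gt0 // ler_expR lerD2r lerN2; apply: ler_sum => i _.
by have [_ _ _ H' _] := Hz i.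
Qed.

End cell_data.

(** * Heavy weights and the final estimate *)

Lemma sum_indicator_le {R : realType} (I : finType) (a : I -> R) (S : pred I) (k : nat) :
  (forall i, 0 <= a i) ->
  \sum_i (S i && (\sum_(j | S j) a j < k%:R * a i))%:R <= k%:R :> R.
Proof.
move=> a0; set A := \sum_(j | S j) a j; set Q := fun i => S i && (A < k%:R * a i).
have A0 : 0 <= A by apply: sumr_ge0.
(* A counted index satisfies A < k a_i, and the a_i over [S] sum to [A]. *)
have QA : (\sum_i (Q i)%:R) * A <= k%:R * A.
  rewrite mulr_suml [leRHS]mulr_sumr [leRHS]big_mkcond; apply: ler_sum => i _.
  rewrite /Q; case: (S i) => /=; last by rewrite mul0r.
  by case: ltP => [/ltW|_]; rewrite ?mul1r // mul0r mulr_ge0.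
move: A0; rewrite le_eqVlt => /orP[/eqP A_0|A_gt0]; last by rewrite -(ler_pM2r A_gt0).
(* When [A = 0] all weights in [S] vanish, and the strict inequality in [Q] leaves nothing to
   count. *)
rewrite big1 ?ler0n // => i _; suff /negbTE : ~~ Q i by rewrite /Q => ->.
apply/negP => /andP[Si]; rewrite -A_0 => H.
have : a i <= A by rewrite /A (bigD1 i) //= lerDl sumr_ge0.
rewrite -A_0 => ai; have : a i = 0 by apply/eqP; rewrite eq_le ai a0.
by move=> ai0; move: H; rewrite ai0 mulr0 ltxx.
Qed.

Theorem theorem3p3 (R : realType) (mu : probability R R) :
  admissible mu -> even_measure mu -> Lstar_condition mu ->
  forall eps : R, 0 < eps ->
  exists n0 : nat, forall (r : R) (n : nat), 0 < r -> (n0 <= n)%N ->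
  forall (d : measure_display) (Omega : measurableType d)
         (P : probability Omega R) (X : 'I_n -> Omega -> R),
    iid_law P X mu ->
    ((expR (- (1 + eps) * r - 2 * eps * n%:R))%:E <=
       ereal_inf [set tukey_depth P X x | x in Bball P X r])%E.
Proof.
move=> [_ _ no_atom _] mu_even cond eps eps0.
have [M [b [M0 Mb tail_b tail_M]]] := Lstar_condition_tail mu mu_even no_atom eps cond eps0.
have eps2 : 0 < eps / 2 by rewrite divr_gt0.
have [N [A [v [delta [C [delta0 mA tA vA tilt]]]]]] :=
  uniform_tilt mu mu_even M b (eps / 2) M0 Mb tail_b eps2.
(* A probability vector on the cells exists, so there is an index [k0] to carry the conditioned
   coordinates. *)
have N_gt0 : (0 < N)%N.
  have [|q [_ [_ + _ _ _]]] := tilt 0; first by rewrite lexx.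
  case: N {A v mA tA vA tilt} q => // q.
  by rewrite big_ord0 => /esym/eqP; rewrite oner_eq0.
pose k0 := Ordinal N_gt0.
set p0 := fine (mu `[b, +oo[%classic).
have p0_le1 : p0 <= 1 by rewrite -lee_fin fineK ?fin_num_measure // probability_le1.
have lnp0 : 0 <= - ln p0 by rewrite oppr_ge0 ln_le0.
(* A common drift for tilted coordinates and for those forced beyond [b]. *)
pose delta' := Num.min delta (b - M).
have delta'0 : 0 < delta' by rewrite lt_min delta0 subr_gt0.
have delta'_le : delta' <= delta by rewrite ge_min lexx.
have delta'_b : delta' <= b - M by rewrite ge_min lexx orbT.
clearbody delta'.
have nat_above (x : R) : exists m : nat, x <= m%:R.
  exists (Num.trunc `|x|).+1; have /truncn_itv/andP[_ /ltW] := normr_ge0 x.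
  exact: le_trans (ler_norm _).
(* Makes C^2/k at most delta'^2/4, so Chebyshev applies to the light coordinates; the added 1 keeps
   [k] positive. *)
have [k kE] := nat_above (4 * C ^+ 2 / delta' ^+ 2 + 1).
have k_gt0 : 0 < k%:R :> R.
  by apply: (lt_le_trans _ kE); rewrite ltr_wpDl // divr_ge0 ?sqr_ge0 // mulr_ge0 ?sqr_ge0.
have kC : C ^+ 2 / k%:R <= delta' ^+ 2 / 4.
  have : 4 * C ^+ 2 / delta' ^+ 2 <= k%:R by apply: le_trans kE; rewrite lerDl.
  rewrite ler_pdivrMr ?exprn_gt0 // => H.
  by rewrite ler_pdivrMr //; lra.
(* [n1] serves Chebyshev for the log-likelihood with deviation eps n; [n2] absorbs the factor 1/2
   and the cost of [k] heavy coordinates into eps n/2. With eps/2 per coordinate from the tilts, the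
   total is 2 eps n. *)
have [n1 n1E] := nat_above (4 * C ^+ 2 / eps ^+ 2).
have [n2 n2E] := nat_above ((ln 2 + k%:R * - ln p0) / (eps / 2)).
exists (maxn n1 n2) => r n r0; rewrite geq_max => /andP[n1n n2n] d Omega P X iidX.
have {n1E}n_large1 : n%:R * C ^+ 2 <= (eps * n%:R) ^+ 2 / 4.
  have : 4 * C ^+ 2 / eps ^+ 2 <= n%:R by apply: (le_trans n1E); rewrite ler_nat.
  rewrite ler_pdivrMr ?exprn_gt0 // => /(ler_wpM2l (ler0n R n)) H.
  by rewrite exprMn; lra.
have {n2E}n_large2 : ln 2 + k%:R * - ln p0 <= eps / 2 * n%:R.
  by rewrite [leRHS]mulrC -ler_pdivrMr // (le_trans n2E) // ler_nat.
apply: le_ereal_inf_tmp => _ [x Bx <-].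
apply: le_ereal_inf_tmp => _ [_ [[a [c [_ ->]]] /= cx] <-].
have [Lx sumL] := Bball_sum_Lstar mu _ _ P _ X iidX mu_even x r Bx.
pose s i := a ord0 i < 0; have iidY := iid_law_flip mu _ _ P _ X iidX mu_even s.
set Y := (fun i w => _) in iidY.
pose y i := `|x ord0 i|; pose L i := fine (Lstar mu (y i)).
have y0 i : 0 <= y i by exact: normr_ge0.
have Ly i : (Lstar mu (y i) < +oo)%E by rewrite /y Lstar_norm.
have L0 i : 0 <= L i by apply: fine_ge0; exact: Lstar_ge0.
have {}sumL : \sum_i L i <= r by rewrite /L /y; under eq_bigr do rewrite Lstar_norm //.
pose al i := `|a ord0 i|; have al0 i : 0 <= al i by exact: normr_ge0.
pose small i := y i <= M; pose S := \sum_(i | small i) al i.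
pose heavy i := small i && (S < k%:R * al i).
(* One formula for all three kinds: the factor 1 + eps pays for coordinates beyond [M], eps/2 for
   the tilt, -ln p0 for heavy ones. *)
pose cost i := (1 + eps) * L i + eps / 2 + (heavy i)%:R * - ln p0.
have cost_ge i : L i <= (1 + eps) * L i by rewrite ler_peMl // lerDl ltW.
have data i : exists (B : 'I_N -> set R) v q l, cell_data mu
    (y i) ((small i)%:R * delta') (cost i) C
    ((small i && ~~ heavy i)%:R * C ^+ 2) B v q l.
  have [yM|yM] := boolP (small i); last first.
    rewrite /= !mul0r; apply: (half_line_data _ k0 _ (y i)) => //.
    + exact: Lstar_lty_tail.
    + by rewrite addr0.
    + have smallF := negbTE yM; rewrite -ltNge in yM; apply: (le_trans (tail_M _ (ltW yM) (Ly i))).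
      by rewrite -/(L i) /cost /heavy smallF mul0r; lra.
  rewrite mul1r; have [hi|hi] := boolP (heavy i).
    rewrite /= mul0r; apply: (half_line_data _ k0 _ b) => //.
      by rewrite /small in yM; lra.
    by rewrite -/p0 /cost hi mul1r; have := L0 i; have := cost_ge i; lra.
  rewrite /= mul1r; have [|q [l [q0 q1 ql qv qlL]]] := tilt (y i); first by rewrite y0.
  exists A, v, q, l; split => //.
  - split => // [k' z|k']; first by have [H _] := vA k'; exact: H.
    by have [] := ql k'.
  - by apply: le_trans qv; rewrite lerD2l.
  - apply: (le_trans qlL); rewrite /cost (negbTE hi) mul0r addr0 lerD2r.
    exact: cost_ge.
  - split; apply: variance_le => // k'; first by have [] := ql k'.
    by have [] := vA k'.
have drift : \sum_i al i * ((small i)%:R * delta') = delta' * S.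
  rewrite /S mulr_sumr [RHS]big_mkcond; apply: eq_bigr => i _.
  by case: (small i); rewrite ?mul1r ?mul0r ?mulr0 // mulrC.
have S0 : 0 <= S by apply: sumr_ge0.
have vars : \sum_i al i ^+ 2 * ((small i && ~~ heavy i)%:R * C ^+ 2) <=
    (\sum_i al i * ((small i)%:R * delta')) ^+ 2 / 4.
  rewrite drift exprMn.
  (* A light weight is at most S/k, so its square is at most S/k times itself; summing gives S^2
     C^2/k. *)
  apply: (@le_trans _ _ (\sum_i (S * (C ^+ 2 / k%:R)) * (if small i then al i else 0))).
    apply: ler_sum => i _; rewrite /heavy; case: (small i) => /=; last first.
      by rewrite mul0r !mulr0.
    case: ltP => H; rewrite ?mul0r ?mulr0 ?mul1r.
      by rewrite mulr_ge0 // mulr_ge0 // divr_ge0 ?sqr_ge0.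
    rewrite (_ : S * (C ^+ 2 / k%:R) * al i = al i * C ^+ 2 * (S / k%:R)); last by ring.
    rewrite (_ : al i ^+ 2 * C ^+ 2 = al i * C ^+ 2 * al i); last by ring.
    apply: ler_wpM2l; first by rewrite mulr_ge0 ?sqr_ge0.
    by rewrite ler_pdivlMr // mulrC.
  rewrite -mulr_sumr -big_mkcond /= -/S.
  have := ler_wpM2l (sqr_ge0 S) kC.
  by lra.
have mXi i : measurable_fun setT (X i) by have [] := iidX.
have dotE w : dotv a (randvec X w) = \sum_i a ord0 i * X i w.
  by apply: eq_bigr => i _; rewrite mxE.
have mD : measurable (randvec X @^-1` [set z | c <= dotv a z]).
  rewrite (_ : _ @^-1` _ = (fun w => \sum_i a ord0 i * X i w) @^-1` `[c, +oo[%classic).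
    rewrite -[X in measurable X]setTI.
    have mf : measurable_fun setT (fun w => \sum_i a ord0 i * X i w).
      by apply: measurable_sum => i; exact: measurable_funM.
    exact: (mf measurableT _ (measurable_itv _)).
  by apply/seteqP; split => w /=; rewrite in_itv /= andbT dotE.
have sD w : \sum_i al i * y i <= \sum_i al i * Y i w ->
    (randvec X @^-1` [set z | c <= dotv a z]) w.
  move=> aw /=; rewrite dotE; apply: (le_trans cx).
  apply: (@le_trans _ _ (\sum_i al i * y i)).
    by apply: ler_sum => i _; apply: (le_trans (ler_norm _)); rewrite normrM.
  apply: (le_trans aw); rewrite le_eqVlt; apply/orP; left; apply/eqP/eq_bigr => i _.
  rewrite /al /Y /s; case: ltP => ai; first by rewrite ltr0_norm // mulrNN.
  by rewrite ger0_norm.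
have shift0 i : 0 <= (small i)%:R * delta' by rewrite mulr_ge0 // ltW.
have epsn0 : 0 <= eps * n%:R by rewrite mulr_ge0 // ltW.
have H := weighted_sum_prob_ge mu _ _ P _ Y al y _ cost _ C _ _ iidY data al0
  shift0 epsn0 n_large1 vars mD sD.
apply: le_trans H.
rewrite lee_fin -[leRHS]lnK; last by rewrite posrE divr_gt0 ?expR_gt0.
rewrite ler_expR ln_div ?posrE ?expR_gt0 // expRK.
have : \sum_i cost i <= (1 + eps) * r + eps / 2 * n%:R + k%:R * - ln p0.
  rewrite !big_split /= -mulr_sumr; apply: lerD; first apply: lerD.
  - by apply: ler_wpM2l => //; lra.
  - by rewrite sumr_const card_ord mulr_natr.
  - by rewrite -mulr_suml ler_wpM2r //; exact: sum_indicator_le.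
by lra.
Qed.
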